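(* Let $p$ be an odd prime, $q=p^k$, $r=p^s$ with $s\mid k$, let $n$ be even with $s\le n/2$, and let $V_n$ be an $n$-dimensional $\mathbb{F}_p$-vector space with a nondegenerate symmetric bilinear form. Let $(P^{(z)})_{z\in\mathbb{F}_q}$ be a family of functions $V_n\to\mathbb{F}_r$ such that: (1) $P^{(cz)}=P^{(z)}$ for all $z\in\mathbb{F}_q$ and $c\in\mathbb{F}_r^*$; (2) every $P^{(z)}$ is vectorial bent with weakly regular components, with sign pattern $(\varepsilon_{z,t})_{t\in\mathbb{F}_r^*}$; for every $z\neq0$, $P^{(z)}$ is of inversion type, with $G^{(z)}\colon V_n\to\mathbb{F}_r$ such that $(P^{(z)}_t)^*=\mathrm{Tr}^s_1(t^{-1}G^{(z)})$ for all $t\in\mathbb{F}_r^*$; and $P^{(0)}$ is vectorial dual-bent, with $G^{(0)}\colon V_n\to\mathbb{F}_r$ vectorial bent and $\sigma_0$ a permutation of $\mathbb{F}_r^*$ such that $(P^{(0)}_t)^*=\mathrm{Tr}^s_1(\sigma_0(t)G^{(0)})$ for all $t\in\mathbb{F}_r^*$; (3) $P^{(0)}(0)=0$ and $G^{(0)}(0)=0$, i.e. $W_{P^{(0)}_t}(0)=\varepsilon_{0,t}\,p^{n/2}$ for all $t\in\mathbb{F}_r^*$. Let $H\colon V=V_n\times\mathbb{F}_q\times\mathbb{F}_q\to\mathbb{F}_r$, $H(x,y,z)=P^{(z)}(x)+\mathrm{Tr}^k_s(yz)$, and let $\Omega_s(H)$ be the partition of $V$ defined in the context. Then $\Omega_s(H)$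 is Fourier-reflexive. Its dual partition is $\Omega_s(K)$ with the roles of the second and third coordinates interchanged, where $K(u,v,w)=G^{(v)}(u)-\mathrm{Tr}^k_s(vw)$ (which is the vectorial dual of $H$ when $\sigma_0(t)=t^{-1}$); that is, the dual partition consists of the nonempty sets among $$\{0\},\quad \{(a,0,c): a\ne0,\ G^{(0)}(a)=i\},\quad \{(a,b,c): b\in L\setminus\{0\},\ K(a,b,c)=i\},\quad \{(0,0,c): c\in L\setminus\{0\}\},$$ with $i\in\mathbb{F}_r$ and $L$ ranging over the one-dimensional $\mathbb{F}_r$-subspaces of $\mathbb{F}_q$. Consequently, if all $P^{(z)}$ are even (i.e. $P^{(z)}(-x)=P^{(z)}(x)$), then $\Omega_s(H)$ induces a symmetric association scheme on $V$ with $$|\Omega_s(H)|-1=\frac{q-1}{r-1}(r+1)+r-1+\delta$$ classes, where $\delta=0$ if $n=2s$ and $\varepsilon_{0,t}=-1$ for all $t\in\mathbb{F}_r^*$, and $\delta=1$ otherwise. In particular, for $s=k$ one obtains $2q+\delta$ classes.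
   Context: Notation: $\mathrm{Tr}^a_b$ is the trace $\mathbb{F}_{p^a}\to\mathbb{F}_{p^b}$ ($b\mid a$); $\zeta_p=e^{2\pi i/p}$. For an even-dimensional $\mathbb{F}_p$-space $V_n$ of dimension $n$ with nondegenerate symmetric bilinear form $\langle\cdot,\cdot\rangle$ and $f\colon V_n\to\mathbb{F}_p$, the Walsh transform is $W_f(b)=\sum_{x\in V_n}\zeta_p^{f(x)-\langle b,x\rangle}$. $f$ is bent if $|W_f(b)|=p^{n/2}$ for all $b$; then (as $n$ is even) $W_f(b)=\varepsilon_f(b)p^{n/2}\zeta_p^{f^*(b)}$ with $\varepsilon_f(b)\in\{\pm1\}$ and a function $f^*\colon V_n\to\mathbb{F}_p$, the dual of $f$. A bent $f$ is weakly regular if $\varepsilon_f$ is constant (this constant is its sign), and non-weakly regular otherwise. For $P\colon V_n\to\mathbb{F}_r$ and $t\in\mathbb{F}_r^*$ the component is $P_t=\mathrm{Tr}^s_1(tP)$. $P$ is vectorial bent if all $P_t$, $t\ne0$, are bent; it has weakly regular components if every $P_t$ is weakly regular, with sign $\varepsilon_{P,t}$; $(\varepsilon_{P,t})_{t\in\mathbb{F}_r^*}$ is its sign pattern. $P$ is vectorial dual-bent if there are a vectorial bent $P^*\colon V_n\to\mathbb{F}_r$ (a vectorial dual) and a permutation $\sigma$ of $\mathbb{F}_r^*$ with $(P_t)^*=(P^* )_{\sigma(t)}$ for all $t\in\mathbb{F}_r^*$. A vectorial bent $P$ is of inversion type if there is $G\colon V_n\to\mathbb{F}_r$ with $(P_t)^*=\mathrm{Tr}^s_1(t^{-1}G)$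 for all $t\in\mathbb{F}_r^*$. $V=V_n\times\mathbb{F}_q\times\mathbb{F}_q$ carries the form $\langle(u,v,w),(x,y,z)\rangle=\langle u,x\rangle+\mathrm{Tr}^k_1(vy)+\mathrm{Tr}^k_1(wz)$. The partition $\Omega_s(H)$: let $\mathcal{L}$ be the set of one-dimensional $\mathbb{F}_r$-subspaces $L$ of $\mathbb{F}_q$. Put $c_{L,i}=\{(x,y,z)\in V: z\in L\setminus\{0\},\ H(x,y,z)=i\}$, $B_L=\{(0,y,0): y\in L\setminus\{0\}\}$, $e_i=\{(x,y,0): x\ne0,\ P^{(0)}(x)=i\}$ for $L\in\mathcal{L}$, $i\in\mathbb{F}_r$. Then $\Omega_s(H)=\{\{0\},\ e_i\ (i\in\mathbb{F}_r),\ c_{L,i}\ (L\in\mathcal{L},i\in\mathbb{F}_r),\ B_L\ (L\in\mathcal{L})\}$, with $e_0$ omitted if it is empty. Fourier-reflexivity: for $\xi\in V$ and $S\subseteq V$ let $\chi_\xi(S)=\sum_{s\in S}\zeta_p^{-\langle\xi,s\rangle}$. The dual partition $\widehat\Omega$ of a partition $\Omega=\{\{0\},U_1,\dots,U_d\}$ of $V$ (with $U_0=\{0\}$) is the partition of $V$ into the level sets of $\xi\mapsto(\chi_\xi(U_0),\dots,\chi_\xi(U_d))$; $\Omega$ is Fourier-reflexive if $|\widehat\Omega|=|\Omega|$. $\Omega$ induces an association scheme if the relations $R_0=\{(x,x)\}$, $R_i=\{(x,y): y-x\in U_i\}$ form a ($d$-class) association scheme on $V$. *)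

(* Defs.v *)
From HB Require Import structures.
From mathcomp Require Import all_boot all_order all_algebra all_fingroup.
From mathcomp Require Import finfield sesquilinear complex.
From mathcomp Require Import reals trigo.

Set Implicit Arguments.
Unset Strict Implicit.
Unset Printing Implicit Defensive.

Import Order.TTheory GRing.Theory Num.Theory.

Local Open Scope ring_scope.

(* exp (2 i pi / p) *)
Definition zeta (R : realType) (p : nat) : R[i] :=
  (cos (2 * pi / p%:R) +i* sin (2 * pi / p%:R))%C.

Section Trace.

(* The trace of L over K along an embedding j : K -> L, as the sum of the     *)
(* conjugates x ^+ (#|K| ^ i), i < [L : K].  This sum lies in the image of j, *)
(* and is read back in K; trunc_log #|K| #|L| is the degree [L : K].          *)
Definition ftrace (K L : finFieldType) (j : K -> L) (x : L) : K :=
  odflt 0 [pick a | j a == \sum_(i < trunc_log #|K| #|L|) x ^+ (#|K| ^ i)].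

(* The prime field is embedded through representatives, which is a morphism   *)
(* as soon as L has characteristic p.                                         *)
Definition absolute_trace (p : nat) (L : finFieldType) : L -> 'F_p :=
  ftrace (fun a : 'F_p => (a : nat)%:R).

End Trace.

Section Bent.

(* N is the (even) dimension over 'F_p of the space carried by T, so that     *)
(* p%:R ^+ N./2 is the square root of #|T|.                                   *)
Variables (C : numClosedFieldType) (z : C) (p : nat) (N : nat).
Variables (T : finType) (form : T -> T -> 'F_p).

Definition walsh (f : T -> 'F_p) (b : T) : C :=
  \sum_x z ^+ (f x - form b x)%R.

Definition bent (f : T -> 'F_p) : Prop :=
  forall b, `|walsh f b| = p%:R ^+ N./2.

Definition walsh_expansion (f : T -> 'F_p) (eps : T -> C) (g : T -> 'F_p) : Prop :=
  forall b, (eps b = 1 \/ eps b = -1) /\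
            walsh f b = eps b * p%:R ^+ N./2 * z ^+ g b.

Definition is_dual (f g : T -> 'F_p) : Prop :=
  exists eps, walsh_expansion f eps g.

Definition weakly_regular (f : T -> 'F_p) (e : C) : Prop :=
  bent f /\ exists g, walsh_expansion f (fun=> e) g.

Variable F : finFieldType.

Definition component (P : T -> F) (t : F) (x : T) : 'F_p :=
  absolute_trace p (t * P x).

Definition vectorial_bent (P : T -> F) : Prop :=
  forall t, t != 0 -> bent (component P t).

Definition weakly_regular_components (P : T -> F) (eps : F -> C) : Prop :=
  forall t, t != 0 -> weakly_regular (component P t) (eps t).

Definition inversion_type_by (P G : T -> F) : Prop :=
  vectorial_bent P /\
  forall t, t != 0 -> is_dual (component P t) (component G t^-1).

(* A permutation of the nonzero elements of F is encoded as a permutation of  *)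
(* F supported on them.                                                       *)
Definition vectorial_dual_by (sigma : {perm F}) (P Q : T -> F) : Prop :=
  [/\ vectorial_bent P, vectorial_bent Q, perm_on [set~ 0] sigma &
      forall t, t != 0 -> is_dual (component P t) (component Q (sigma t))].

Definition vectorial_dual (P Q : T -> F) : Prop :=
  exists sigma, vectorial_dual_by sigma P Q.

End Bent.

Section FourierReflexive.

Variables (C : numClosedFieldType) (z : C) (p : nat).
Variables (T : finType) (form : T -> T -> 'F_p).

Definition chi (xi : T) (S : {set T}) : C :=
  \sum_(s in S) z ^+ (- form xi s)%R.

Definition dual_partition (Om : {set {set T}}) : {set {set T}} :=
  equivalence_partition
    (fun xi xi' => [forall U in Om, chi xi U == chi xi' U]) [set: T].

Definition Fourier_reflexive (Om : {set {set T}}) : Prop :=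
  #|dual_partition Om| = #|Om|.

End FourierReflexive.

Section AssociationScheme.

Variable X : finType.

Definition converse (S : {set X * X}) : {set X * X} :=
  [set xy | (xy.2, xy.1) \in S].

Definition association_scheme (d : nat) (RR : {set {set X * X}}) : Prop :=
  [/\ #|RR| = d.+1,
      partition RR [set: X * X],
      [set xy | xy.1 == xy.2] \in RR,
      {in RR, forall S, converse S \in RR} &
      forall S1 S2 S3, S1 \in RR -> S2 \in RR -> S3 \in RR ->
        exists m : nat, forall x y, (x, y) \in S3 ->
          #|[set w | ((x, w) \in S1) && ((w, y) \in S2)]| = m /\
          #|[set w | ((x, w) \in S2) && ((w, y) \in S1)]| = m].

Definition symmetric_association_scheme (d : nat) (RR : {set {set X * X}}) : Prop :=
  association_scheme d RR /\ {in RR, forall S, converse S = S}.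

End AssociationScheme.

Definition difference_relations (V : finZmodType) (Om : {set {set V}}) :
    {set {set V * V}} :=
  [set [set xy | xy.2 - xy.1 \in U] | U : {set V} in Om].

(* finvect_type Vn is Vn with its finite type structure. *)
Definition fin_form (p : nat) (Vn : vectType 'F_p) (form : Vn -> Vn -> 'F_p) :
    finvect_type Vn -> finvect_type Vn -> 'F_p :=
  form.

Definition ambient (p : nat) (Vn : vectType 'F_p) (Fq : finFieldType) :
    predArgType :=
  (finvect_type Vn * Fq * Fq)%type.

HB.instance Definition _ p Vn Fq := Finite.on (@ambient p Vn Fq).
HB.instance Definition _ p Vn Fq := GRing.Zmodule.on (@ambient p Vn Fq).

Section Construction.

Variables (p : nat) (Vn : vectType 'F_p) (form : Vn -> Vn -> 'F_p).
Variables (Fr Fq : finFieldType) (j : Fr -> Fq).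

Local Notation V := (ambient Vn Fq).

Definition ambient_form (v v' : V) : 'F_p :=
  form v.1.1 v'.1.1 + absolute_trace p (v.1.2 * v'.1.2)
  + absolute_trace p (v.2 * v'.2).

Definition H_fun (P : Fq -> finvect_type Vn -> Fr) (v : V) : Fr :=
  P v.2 v.1.1 + ftrace j (v.1.2 * v.2).

Definition K_fun (G : Fq -> finvect_type Vn -> Fr) (v : V) : Fr :=
  G v.1.2 v.1.1 - ftrace j (v.1.2 * v.2).

(* The one-dimensional Fr-subspaces of Fq, as spans of nonzero vectors. *)
Definition flines : {set {set Fq}} :=
  [set [set j c * v | c : Fr] | v in [set~ 0]].

Section Omega.

Variables (P0 : finvect_type Vn -> Fr) (H : V -> Fr).

Definition c_ (L : {set Fq}) (i : Fr) : {set V} :=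
  [set v : V | (v.2 \in L :\ 0) && (H v == i)].

Definition B_ (L : {set Fq}) : {set V} :=
  [set v : V | [&& v.1.1 == 0, v.1.2 \in L :\ 0 & v.2 == 0]].

Definition e_ (i : Fr) : {set V} :=
  [set v : V | [&& v.1.1 != 0, P0 v.1.1 == i & v.2 == 0]].

Definition Omega : {set {set V}} :=
  [set [set 0]]
  :|: [set e_ i | i : Fr & (i == 0) ==> (e_ i != set0)]
  :|: [set c_ L i | L in flines, i in [set: Fr]]
  :|: [set B_ L | L in flines].

End Omega.

(* Omega with the second and third coordinates interchanged. *)
Section SwappedOmega.

Variables (G0 : finvect_type Vn -> Fr) (K : V -> Fr).

Definition c_swap (L : {set Fq}) (i : Fr) : {set V} :=
  [set v : V | (v.1.2 \in L :\ 0) && (K v == i)].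

Definition B_swap (L : {set Fq}) : {set V} :=
  [set v : V | [&& v.1.1 == 0, v.1.2 == 0 & v.2 \in L :\ 0]].

Definition e_swap (i : Fr) : {set V} :=
  [set v : V | [&& v.1.1 != 0, G0 v.1.1 == i & v.1.2 == 0]].

Definition Omega_swap : {set {set V}} :=
  ([set [set 0]]
   :|: [set e_swap i | i : Fr]
   :|: [set c_swap L i | L in flines, i in [set: Fr]]
   :|: [set B_swap L | L in flines]) :\ set0.

End SwappedOmega.

End Construction.

(* Main.v *)
(* Twisting the indicators of the level sets of H by the characters of Fr
   replaces the character sums of the blocks c_{L,i} and e_i by Walsh values of
   the components of P^(z), which weak regularity expresses through G^(z), and
   the sums of the B_L record hyperplanes, hence lines.  The level sets of all
   these sums are exactly the blocks built from K.  Both partitions are fibers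
   of a map to a set of labels whose image is the same on both sides: for i <> 0
   there is a nonzero x with P^(0)(x) = i because 2s <= n, and for i = 0 the
   count of such x, computed from the Walsh transforms at 0, vanishes exactly
   when n = 2s and all signs are -1, in which case the same holds for G^(0).
   Finally, equality of the cardinals makes the matrix of character sums square
   and invertible, so the span of the indicators of the blocks is closed under
   convolution, which gives the intersection numbers. *)
Require Import Defs.
From HB Require Import structures.
From mathcomp Require Import all_boot all_order all_algebra all_fingroup.
From mathcomp Require Import finfield sesquilinear complex.
From mathcomp Require Import reals trigo.

Set Implicit Arguments.
Unset Strict Implicit.
Unset Printing Implicit Defensive.

Import Order.TTheory GRing.Theory Num.Theory.

Local Open Scope ring_scope.

(* Keeps /= from unfolding the exponents z ^+ (- a)%R into modular arithmetic. *)
#[local] Arguments nat_of_ord : simpl never.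

(** * Additive characters and Fourier-reflexive partitions *)

(** A Walsh value shows only the product of a sign and a root of unity, and the signs vary with the
    index of the family and with [t]. Since [p] is odd the two factors can be separated, and the
    invariance of [P] under scaling of its index makes the sign constant along each line, so it
    reveals nothing beyond the line. The same invariance drives the computation at a point (a, b,
    c): summing over [y] leaves only the slice z = t^-1 b, where the function is again P^(b), and
    inversion type puts the same factor t^-1 on G^(b)(a) and on Tr(bc), so that both merge into t^-1
    K(a, b, c). On the slice z = 0 there is no trace term to match, which is why any permutation
    [sigma0] is allowed there. The untwisted sums t = 0 are needed as well: for b = 0 they detect
    whether a = 0, and if so the line of c. *)

Section AdditiveCharacters.

Variables (C : numClosedFieldType) (z : C) (p : nat).
Hypotheses (p_prime : prime p) (z_prim : p.-primitive_root z).

Lemma char_natr (n : nat) : z ^+ (n%:R : 'F_p)%R = z ^+ n.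
Proof. by rewrite (val_Fp_nat p_prime) (prim_expr_mod z_prim). Qed.

Lemma char0 : z ^+ (0 : 'F_p)%R = 1.
Proof. by rewrite (char_natr 0). Qed.

Lemma charD (a b : 'F_p) : z ^+ (a + b)%R = z ^+ a * z ^+ b.
Proof. by rewrite -[a]natr_Zp -[b]natr_Zp -natrD !char_natr exprD. Qed.

Lemma char_neq0 (a : 'F_p) : z ^+ a != 0.
Proof. by rewrite expf_neq0 // (prim_root_eq0 z_prim) -lt0n prime_gt0. Qed.

Lemma char_expp (a : 'F_p) : (z ^+ a) ^+ p = 1.
Proof. by rewrite exprAC (prim_expr_order z_prim) expr1n. Qed.

Lemma norm_char (a : 'F_p) : `|z ^+ a| = 1.
Proof.
have:= congr1 Num.norm (char_expp a); rewrite normrX normr1 => /eqP.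
by rewrite pexpr_eq1 ?prime_gt0 // => /eqP.
Qed.

Lemma char_inj (a b : 'F_p) : z ^+ a = z ^+ b -> a = b.
Proof.
move/eqP; rewrite (eq_prim_root_expr z_prim) => /eqP eq_ab.
by rewrite -[a]natr_Zp -[b]natr_Zp; apply: val_inj; rewrite /= !(val_Fp_nat p_prime).
Qed.

Definition is_sign (e : C) := e = 1 \/ e = -1.

Lemma is_sign_neq0 e : is_sign e -> e != 0.
Proof. by case=> ->; rewrite ?oppr_eq0 oner_eq0. Qed.

Lemma is_sign_norm e : is_sign e -> `|e| = 1.
Proof. by case=> ->; rewrite ?normrN normr1. Qed.

(* -1 is not a p-th root of unity. *)
Lemma sign_char_inj e e' (a b : 'F_p) : odd p -> is_sign e -> is_sign e' ->
  e * z ^+ a = e' * z ^+ b -> e = e' /\ a = b.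
Proof.
move=> p_odd se se' eq_ez; suff ee': e = e'.
  by split=> //; apply: char_inj; apply: (mulfI (is_sign_neq0 se)); rewrite {2}ee'.
have := congr1 (fun c => c ^+ p) eq_ez.
rewrite !exprMn !char_expp !mulr1.
by case: se => ->; case: se' => -> //; rewrite expr1n -signr_odd p_odd.
Qed.

(** Stated for bare additive groups so that one Fourier theory serves the form on [Vn], the trace
    forms of both fields and the form on the ambient space. *)
Definition perfect_pairing (T : finZmodType) (f : T -> T -> 'F_p) :=
  [/\ forall u v, f u v = f v u,
      forall u v w, f (u + v) w = f u w + f v w &
      forall v, (forall u, f u v = 0) -> v = 0].

Section Pairing.

Variables (T : finZmodType) (f : T -> T -> 'F_p).
Hypothesis f_perfect : perfect_pairing f.

Lemma pairingC u v : f u v = f v u.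
Proof. by case: f_perfect. Qed.

Lemma pairingDl u v w : f (u + v) w = f u w + f v w.
Proof. by case: f_perfect. Qed.

Lemma pairing0l w : f 0 w = 0.
Proof. by apply: (addrI (f 0 w)); rewrite -pairingDl !addr0. Qed.

Lemma pairingNl u w : f (- u) w = - f u w.
Proof. by apply: (addrI (f u w)); rewrite -pairingDl !subrr pairing0l. Qed.

Lemma pairingDr u v w : f u (v + w) = f u v + f u w.
Proof. by rewrite pairingC pairingDl !(pairingC u). Qed.

Lemma pairing0r w : f w 0 = 0.
Proof. by rewrite pairingC pairing0l. Qed.

Lemma pairingNr u w : f u (- w) = - f u w.
Proof. by rewrite pairingC pairingNl pairingC. Qed.

(** Translation by some [u0] with [f u0 v != 0] multiplies the sum by a root of unity other than
    1. *)
Lemma sum_char v : \sum_u z ^+ (f u v) = (#|T| * (v == 0))%:R.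
Proof.
have [-> | nz_v] := eqVneq v 0.
  under eq_bigr do rewrite pairing0r char0.
  by rewrite sumr_const muln1.
have /existsP[u0 nz_u0] : [exists u, f u v != 0].
  apply: contraNT nz_v; rewrite negb_exists => /forallP f0.
  by case: f_perfect => _ _ f_nd; apply/eqP/f_nd => u; apply/eqP; rewrite -[_ == _]negbK f0.
have: (1 - z ^+ (f u0 v)) * (\sum_u z ^+ (f u v)) = 0.
  rewrite mulrBl mul1r [X in X - _](reindex_inj (addIr u0)) mulr_sumr -sumrB.
  by apply: big1 => u _; rewrite pairingDl charD mulrC subrr.
move/eqP; rewrite mulf_eq0 subr_eq0 muln0 => /orP[/eqP one_z|/eqP//].
by rewrite -(char_inj (etrans char0 one_z)) eqxx in nz_u0.
Qed.

Lemma Fourier_inversion (g : T -> C) y :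
  \sum_xi z ^+ (f xi y) * \sum_x g x * z ^+ (- f xi x)%R = #|T|%:R * g y.
Proof.
under eq_bigr do rewrite mulr_sumr.
rewrite exchange_big (bigD1 y) //= [X in _ + X]big1 ?addr0 => [|x neq_xy].
  under eq_bigr do rewrite mulrCA -charD subrr char0 mulr1.
  by rewrite sumr_const mulr_natl.
under eq_bigr do rewrite mulrCA -charD -pairingNr -pairingDr.
by rewrite -mulr_sumr sum_char subr_eq0 [y == x]eq_sym (negPf neq_xy) muln0 mulr0.
Qed.

Lemma card_neq0 : #|T|%:R != 0 :> C.
Proof. by rewrite pnatr_eq0 -lt0n; apply/card_gt0P; exists 0. Qed.

Lemma Fourier_inj (g : T -> C) :
  (forall xi, \sum_x g x * z ^+ (- f xi x)%R = 0) -> forall y, g y = 0.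
Proof.
move=> g0 y; apply: (mulfI card_neq0); rewrite mulr0 -Fourier_inversion.
by apply: big1 => xi _; rewrite g0 mulr0.
Qed.

(** Convolution of two indicators; at [y - x] it is the intersection number seen from the pair
    [(x, y)]. *)
Definition conv (U1 U2 : {set T}) x := #|[set w in U1 | x - w \in U2]|.

Lemma chi_conv xi U1 U2 :
  chi z f xi U1 * chi z f xi U2 = \sum_x (conv U1 U2 x)%:R * z ^+ (- f xi x)%R.
Proof.
transitivity (\sum_(u in U1) \sum_x (x - u \in U2)%:R * z ^+ (- f xi x)%R).
  rewrite /chi mulr_suml; apply: eq_bigr => u _.
  rewrite mulr_sumr [RHS](reindex_inj (addIr u)) [LHS]big_mkcond.
  apply: eq_bigr => v _; rewrite addrK; case: ifP; rewrite ?mul0r // mul1r.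
  by rewrite -charD -opprD -pairingDr addrC.
rewrite exchange_big; apply: eq_bigr => x _; rewrite -mulr_suml; congr (_ * _).
rewrite /conv -sum1_card natr_sum [RHS](eq_bigl _ _ (fun w => in_set _ _)).
by rewrite big_mkcondr; apply: eq_bigr => w _; case: ifP.
Qed.

(** * Association schemes from Fourier-reflexive partitions *)

Section Scheme.

Variable Om : {set {set T}}.
Hypothesis Om_part : partition Om [set: T].
Hypothesis Om_reflexive : Fourier_reflexive z f Om.

Let same_chi xi xi' := [forall U in Om, chi z f xi U == chi z f xi' U].
Let D := dual_partition z f Om.
Let U (i : 'I_#|Om|) : {set T} := enum_val i.

Lemma dual_part : partition D [set: T].
Proof.
apply: equivalence_partitionP => x y w _ _ _; split;
  first by apply/forallP=> S; rewrite eqxx implybT.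
move=> /forallP xy; apply/forallP/forallP => h S; have := h S; have := xy S;
  by case: (S \in Om) => //= /eqP->.
Qed.

Lemma dual_blockP (W : {set T}) : W \in D ->
  exists2 x, x \in W & forall y, y \in W -> same_chi x y.
Proof.
by case/imsetP=> x _ ->; exists x; rewrite ?inE;
  [apply/forallP=> S; rewrite eqxx implybT | move=> y; rewrite !inE].
Qed.

Let rep (W : {set T}) := odflt 0 [pick x in W].

(** Sums over blocks depend only on the dual block of [xi], so a matrix with one column per dual
    block records all of them. *)
Lemma same_chi_rep xi : exists j : 'I_#|D|,
  forall S, S \in Om -> chi z f xi S = chi z f (rep (enum_val j)) S.
Proof.
have cov: xi \in cover D by rewrite (cover_partition dual_part).
have WD := pblock_mem cov; exists (enum_rank_in WD (pblock D xi)).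
rewrite enum_rankK_in // => S SOm.
have [x0 _ same] := dual_blockP WD.
have /same/forall_inP/(_ S SOm)/eqP <- : xi \in pblock D xi by rewrite mem_pblock.
rewrite /rep; case: pickP => [y /same/forall_inP/(_ S SOm)/eqP -> // | /(_ xi)].
by rewrite mem_pblock cov.
Qed.

Lemma block_pick x : exists i, x \in U i.
Proof.
have cov: x \in cover Om by rewrite (cover_partition Om_part).
have BOm := pblock_mem cov; exists (enum_rank_in BOm (pblock Om x)).
by rewrite /U enum_rankK_in // mem_pblock.
Qed.

Lemma block_unique i i' x : x \in U i -> (x \in U i') = (i' == i).
Proof.
move=> xi; apply/idP/eqP => [xi' | -> //]; apply: enum_val_inj.
have tI := partition_trivIset Om_part.
by rewrite -/(U i) -/(U i') -(def_pblock tI _ xi) ?enum_valP //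
  -(def_pblock tI _ xi') ?enum_valP.
Qed.

Lemma sum_blocks (a : 'I_#|Om| -> C) xi :
  \sum_i a i * chi z f xi (U i)
    = \sum_x (\sum_i a i * (x \in U i)%:R) * z ^+ (- f xi x)%R.
Proof.
under [RHS]eq_bigr do rewrite mulr_suml.
rewrite exchange_big; apply: eq_bigr => i _.
rewrite /chi mulr_sumr big_mkcond; apply: eq_bigr => x _.
by case: ifP; rewrite ?mulr1 // mulr0 mul0r.
Qed.

Lemma sum_block_unique (a : 'I_#|Om| -> C) i x : x \in U i ->
  \sum_i' a i' * (x \in U i')%:R = a i.
Proof.
move=> xi; rewrite (bigD1 i) //= xi mulr1 big1 ?addr0 // => i' neq.
by rewrite (block_unique _ xi) (negPf neq) mulr0.
Qed.

(* The matrix of character sums is square because |dual Om| = |Om| and has    *)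
(* independent rows by Fourier inversion, so the products of two of its rows  *)
(* are combinations of its rows.                                              *)
Lemma conv_block_eq U1 U2 U3 x y : U1 \in Om -> U2 \in Om -> U3 \in Om ->
  x \in U3 -> y \in U3 -> conv U1 U2 x = conv U1 U2 y.
Proof.
move=> U1Om U2Om U3Om xU3 yU3.
pose M := \matrix_(i < #|Om|, j < #|D|) chi z f (rep (enum_val j)) (U i).
have freeM : row_free M.
  apply: inj_row_free => v vM0; apply/rowP => i; rewrite mxE.
  have v0 xi : \sum_i v 0 i * chi z f xi (U i) = 0.
    have [j eq_chi] := same_chi_rep xi.
    have := congr1 (fun A : 'rV_ _ => A 0 j) vM0; rewrite !mxE => sum0.
    by rewrite -[RHS]sum0; apply: eq_bigr => i' _; rewrite mxE eq_chi ?enum_valP.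
  have Ui0 : U i != set0.
    by apply: contraTneq (enum_valP i) => Ui0; rewrite -/(U i) Ui0; case/and3P: Om_part.
  have [w wUi] := set0Pn _ Ui0.
  rewrite -(sum_block_unique (v 0) wUi).
  by apply: (Fourier_inj (g := fun x => \sum_i v 0 i * (x \in U i)%:R)) => xi;
    rewrite -sum_blocks.
have fullM : row_full M.
  by move: freeM; rewrite /row_free /row_full => /eqP->; rewrite -Om_reflexive.
pose u : 'rV_#|D| := \row_j (chi z f (rep (enum_val j)) U1 * chi z f (rep (enum_val j)) U2).
have /submxP[a def_u] : (u <= M)%MS by apply: submx_full.
have combE xi : \sum_i a 0 i * chi z f xi (U i) = chi z f xi U1 * chi z f xi U2.
  have [j eq_chi] := same_chi_rep xi.
  have := congr1 (fun A : 'rV_ _ => A 0 j) def_u; rewrite !mxE !eq_chi // => ->.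
  by apply: eq_bigr => i' _; rewrite mxE eq_chi ?enum_valP.
(* The product of two rows is the transform of [conv U1 U2], a combination of rows that of a
   function constant on blocks; injectivity of the transform identifies the functions. *)
have convE w : (conv U1 U2 w)%:R = \sum_i a 0 i * (w \in U i)%:R :> C.
  apply/eqP; rewrite -subr_eq0; apply/eqP; move: w.
  apply: (Fourier_inj (g := fun w => (conv U1 U2 w)%:R
    - \sum_i a 0 i * (w \in U i)%:R)) => xi.
  under eq_bigr do rewrite mulrBl.
  by rewrite sumrB -chi_conv -sum_blocks combE subrr.
have [i def_U3] : exists i, U i = U3.
  by exists (enum_rank_in U3Om U3); rewrite /U enum_rankK_in.
apply/eqP; rewrite -(eqr_nat C) !convE.
by rewrite !(@sum_block_unique _ i) ?def_U3.
Qed.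

Let rel_of (S : {set T}) := [set xy : T * T | xy.2 - xy.1 \in S].

Lemma rel_of_inj : injective rel_of.
Proof.
move=> S S' /setP eqS; apply/setP => x.
by have := eqS (0, x); rewrite !inE subr0.
Qed.

Lemma difference_relations_partition : partition (difference_relations Om) setT.
Proof.
apply/and3P; split.
- apply/eqP/setP => -[x y]; rewrite inE; apply/bigcupP.
  have [i xyi] := block_pick (y - x).
  by exists (rel_of (U i)); rewrite ?inE // imset_f ?enum_valP.
- apply/trivIsetP => _ _ /imsetP[S SOm ->] /imsetP[S' S'Om ->] neqS.
  have neq: S != S' by apply: contraNneq neqS => ->.
  apply/pred0P => -[x y]; rewrite /= !inE /=; apply/andP => -[xS xS'].
  have /trivIsetP/(_ S S' SOm S'Om neq)/disjointFr := partition_trivIset Om_part.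
  by move/(_ _ xS); rewrite xS'.
- apply/imsetP => -[S SOm /setP S0].
  have /set0Pn[x xS]: S != set0 by apply: contraTneq SOm => ->; case/and3P: Om_part.
  by have := S0 (0, x); rewrite !inE /= subr0 xS.
Qed.

(** Closure of the blocks under negation makes each relation its own converse; the intersection
    numbers are values of [conv], constant on blocks. *)
Lemma Fourier_reflexive_scheme : [set 0] \in Om ->
  (forall S x, S \in Om -> x \in S -> - x \in S) ->
  symmetric_association_scheme #|Om|.-1 (difference_relations Om).
Proof.
move=> Om0 OmN.
have conv_rel S : S \in Om -> converse (rel_of S) = rel_of S.
  move=> SOm; apply/setP => -[x y]; rewrite !inE /=.
  by apply/idP/idP => /(OmN _ _ SOm); rewrite opprB.
split; last by move=> _ /imsetP[S SOm ->]; apply: conv_rel.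
split.
- rewrite card_imset; last exact: rel_of_inj.
  by rewrite prednK //; apply/card_gt0P; exists [set 0].
- exact: difference_relations_partition.
- apply/imsetP; exists [set 0] => //; apply/setP => -[x y].
  by rewrite !inE /= subr_eq0 eq_sym.
- by move=> _ /imsetP[S SOm ->]; rewrite (conv_rel S) // imset_f.
move=> _ _ _ /imsetP[S1 S1Om ->] /imsetP[S2 S2Om ->] /imsetP[S3 S3Om ->].
have /set0Pn[x0 x0S3]: S3 != set0 by apply: contraTneq S3Om => ->; case/and3P: Om_part.
exists (conv S1 S2 x0) => x y; rewrite inE /= => xyS3.
rewrite (conv_block_eq S1Om S2Om S3Om x0S3 xyS3) /conv; split.
  rewrite -[RHS](card_imset _ (addIr x)); apply: eq_card => w; rewrite !inE /=.
  apply/andP/imsetP => [[w1 w2] | [v]].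
    by exists (w - x); rewrite ?subrK // inE w1 opprB addrA subrK.
  by rewrite inE => /andP[v1 v2] ->; rewrite addrK v1 opprD addrA addrAC.
(* For the opposite order the translation by [x] is replaced by the reflection sending [w] to
   [y - w], which exchanges the two factors. *)
rewrite -[RHS](card_imset _ (can_inj (subKr y))); apply: eq_card => w; rewrite !inE /=.
apply/andP/imsetP => [[w1 w2] | [v]].
  by exists (y - w); rewrite ?subKr // inE w2 opprB addrC addrA subrK.
by rewrite inE => /andP[v1 v2] ->; rewrite subKr addrAC.
Qed.

End Scheme.

End Pairing.

End AdditiveCharacters.

(** * Traces of finite fields *)

Section FieldTrace.

Variables (p s d : nat) (K L : finFieldType) (j : {rmorphism K -> L}).
Hypotheses (p_prime : prime p) (card_K : #|K| = (p ^ s)%N).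
Hypothesis card_L : #|L| = (#|K| ^ d)%N.

Let d_gt0 : (0 < d)%N.
Proof. by have := finNzRing_gt1 L; rewrite card_L; case: d. Qed.

Lemma expf_cardX (x : K) i : x ^+ (#|K| ^ i) = x.
Proof. by elim: i => // i IHi; rewrite expnSr exprM IHi expf_card. Qed.

Lemma expD_cardX i : {morph (fun x : L => x ^+ (#|K| ^ i)) : x y / x + y}.
Proof.
move=> x y; apply: exprDn_pchar.
have pL : p \in [pchar L].
  by apply: (@card_finPcharP L p (s * d)) => //; rewrite card_L card_K expnM.
by rewrite (eq_pnat _ (pcharf_eq pL)) card_K -expnM pnatX pnat_id.
Qed.

Lemma exp_cardX0 i : (0 : L) ^+ (#|K| ^ i) = 0.
Proof. by rewrite expr0n expn_eq0 -leqn0 leqNgt ltnW ?finNzRing_gt1. Qed.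

(** Such a [y] is a root of X^|K| - X, which splits over [K] into the factors X - a. *)
Lemma rmorph_image (y : L) : y ^+ #|K| = y -> exists a, j a = y.
Proof.
move=> y_fix.
have := congr1 (fun P => (map_poly j P).[y]) (finField_genPoly K).
rewrite rmorphB rmorph_prod rmorphXn /= map_polyX !hornerE y_fix subrr horner_prod.
move/esym/eqP/prodf_eq0 => [a _].
by rewrite rmorphB /= map_polyX map_polyC !hornerE subr_eq0 => /eqP->; exists a.
Qed.

(** The default value in [ftrace] is never reached: raising the sum of conjugates to the power |K|
    permutes its terms cyclically, because x^|L| = x, so the sum lies in the image of [j]. *)
Lemma ftraceE x : j (ftrace j x) = \sum_(i < d) x ^+ (#|K| ^ i).
Proof.
rewrite /ftrace card_L trunc_expnK ?finNzRing_gt1 //.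
case: pickP => [a /eqP // | no_a].
have [|a ja] := @rmorph_image (\sum_(i < d) x ^+ (#|K| ^ i)).
  have -> : #|K| = (#|K| ^ 1)%N by [].
  rewrite (big_morph _ (@expD_cardX 1) (exp_cardX0 1)) expn1.
  under eq_bigr do rewrite -exprM -expnSr.
  case: d d_gt0 card_L => // d' _ card_L'.
  rewrite big_ord_recr big_ord_recl /= -card_L' expf_card addrC.
  by congr (_ + _); apply: eq_bigr.
by have := no_a a; rewrite ja eqxx.
Qed.

Lemma ftraceD : {morph ftrace j : x y / x + y}.
Proof.
move=> x y; apply: (fmorph_inj j); rewrite rmorphD /= !ftraceE -big_split.
by apply: eq_bigr => i _; rewrite (expD_cardX i).
Qed.

Lemma ftraceZ a x : ftrace j (j a * x) = a * ftrace j x.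
Proof.
apply: (fmorph_inj j); rewrite rmorphM /= !ftraceE mulr_sumr.
by apply: eq_bigr => i _; rewrite exprMn -rmorphXn expf_cardX.
Qed.

Lemma ftrace0 : ftrace j 0 = 0.
Proof. by have := ftraceZ 0 0; rewrite rmorph0 !mul0r. Qed.

Lemma ftraceN x : ftrace j (- x) = - ftrace j x.
Proof. by have := ftraceZ (-1) x; rewrite rmorphN rmorph1 !mulN1r. Qed.

(* The trace polynomial has degree |K| ^ (d - 1) < |L|, hence a non-root. *)
Lemma ftrace_neq0 : exists x, ftrace j x != 0.
Proof.
apply/existsP; apply: contraT; rewrite negb_exists => /forallP tr0.
pose T : {poly L} := \sum_(i < d) 'X^(#|K| ^ i).
have K_gt1 := finNzRing_gt1 K.
have T_neq0 : T != 0.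
  apply: contraNneq (oner_neq0 L) => T0; rewrite -[0](coef0 L 1) -T0 coef_sum.
  rewrite (bigD1 (Ordinal d_gt0)) //= coefXn expn0 eqxx big1 ?addr0 // => i.
  rewrite -val_eqE /= coefXn => i_neq0.
  by rewrite eq_sym -(expn0 #|K|) eqn_exp2l // (negPf i_neq0).
have := @max_poly_roots _ T (enum L) T_neq0.
rewrite enum_uniq -cardE => /(_ _ isT) size_T.
suff /size_T : all (root T) (enum L).
  have -> : #|L| = (#|K| * #|K| ^ d.-1)%N by rewrite -expnS prednK.
  suff size_le : (size T <= (#|K| ^ d.-1).+1)%N.
    move/leq_trans/(_ size_le); rewrite ltnS leqNgt ltn_Pmull //.
    by rewrite expn_gt0 ltnW.
  apply: (leq_trans (size_sum _ _ _)); apply/bigmax_leqP => i _.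
  rewrite size_polyXn ltnS leq_exp2l // -ltnS prednK //.
apply/allP => x _; rewrite /root horner_sum.
under eq_bigr do rewrite hornerXn.
by rewrite -ftraceE (eqP (negbNE (tr0 x))) rmorph0.
Qed.

Lemma ftrace_surj a : exists x, ftrace j x = a.
Proof.
have [x nz_x] := ftrace_neq0.
by exists (j (a / ftrace j x) * x); rewrite ftraceZ divfK.
Qed.

End FieldTrace.

(** * The trace to the prime field and transitivity *)

Section AbsoluteTrace.

Variables (p k : nat) (L : finFieldType).
Hypotheses (p_prime : prime p) (card_L : #|L| = (p ^ k)%N).

Let j (a : 'F_p) : L := (a : nat)%:R.

Lemma prime_embedding_nat n : j n%:R = n%:R.
Proof.
have pL := card_finPcharP card_L p_prime.
rewrite /j (val_Fp_nat p_prime) [in RHS](divn_eq n p) natrD natrM.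
by rewrite (pcharf0 pL) mulr0 add0r.
Qed.

Lemma prime_embedding : {jm : {rmorphism 'F_p -> L} | jm =1 j}.
Proof.
have jB : zmod_morphism j.
  move=> a b; apply: (addIr (j b)); rewrite subrK -[a]natr_Zp -[b]natr_Zp.
  move: (a : nat) (b : nat) => m n; rewrite -[_ - _]natr_Zp !prime_embedding_nat.
  by rewrite -natrD -prime_embedding_nat natrD natr_Zp subrK prime_embedding_nat.
have jM : monoid_morphism j.
  split=> [|a b]; first exact: (prime_embedding_nat 1).
  by rewrite -[a]natr_Zp -[b]natr_Zp -natrM !prime_embedding_nat natrM.
pose A := GRing.isZmodMorphism.Build _ _ j jB.
pose M := GRing.isMonoidMorphism.Build _ _ j jM.
pose jm : {rmorphism 'F_p -> L} := HB.pack j A M.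
by exists jm.
Qed.

Let card_Fp1 : #|'F_p| = (p ^ 1)%N. Proof. by rewrite card_Fp. Qed.
Let card_LF : #|L| = (#|'F_p| ^ k)%N. Proof. by rewrite card_Fp. Qed.

Lemma absolute_trace_rmorphism :
  {jm : {rmorphism 'F_p -> L} | jm =1 j & @absolute_trace p L =1 ftrace jm}.
Proof.
have [jm jmE] := prime_embedding; exists jm => // x.
rewrite /absolute_trace /ftrace; congr odflt; apply: eq_pick => a /=.
by rewrite jmE.
Qed.

Lemma absolute_traceE (x : L) : (absolute_trace p x : nat)%:R = \sum_(i < k) x ^+ (p ^ i).
Proof.
have [jm jmE ->] := absolute_trace_rmorphism.
rewrite -[LHS]/(j _) -jmE (ftraceE jm p_prime card_Fp1 card_LF) card_Fp //.
Qed.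

Lemma absolute_traceD : {morph @absolute_trace p L : x y / x + y}.
Proof.
have [jm _ trE] := absolute_trace_rmorphism => x y; rewrite !trE.
exact: ftraceD p_prime card_Fp1 card_LF _ _.
Qed.

Lemma absolute_trace0 : absolute_trace p (0 : L) = 0.
Proof. by apply: (addIr (absolute_trace p (0 : L))); rewrite -absolute_traceD !add0r. Qed.

Lemma absolute_traceN (x : L) : absolute_trace p (- x) = - absolute_trace p x.
Proof.
by apply: (addIr (absolute_trace p x)); rewrite -absolute_traceD !addNr absolute_trace0.
Qed.

Lemma absolute_trace_pairing :
  perfect_pairing (fun x y : L => absolute_trace p (x * y)).
Proof.
split=> [x y | x y w | y tr0]; rewrite ?[y * x]mulrC ?mulrDl ?absolute_traceD //.
apply/eqP; apply: contraT => nz_y.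
have [jm _ trE] := absolute_trace_rmorphism.
have [x] := ftrace_neq0 jm p_prime card_Fp1 card_LF.
by rewrite -trE -[x](divfK nz_y) tr0 eqxx.
Qed.

End AbsoluteTrace.

(** Writing an exponent m < s d as l s + i groups the conjugates x^(p^m) into the p^i-th powers of
    the conjugates of [x] over [K]. *)
Lemma absolute_trace_trans (p s d : nat) (K L : finFieldType) (j : {rmorphism K -> L}) :
    prime p -> #|K| = (p ^ s)%N -> #|L| = (#|K| ^ d)%N ->
  forall x, absolute_trace p (ftrace j x) = absolute_trace p x.
Proof.
move=> p_prime card_K card_L x.
have card_L' : #|L| = (p ^ (s * d))%N by rewrite card_L card_K expnM.
have [jm jmE _] := absolute_trace_rmorphism p_prime card_L'.
apply: (fmorph_inj jm); rewrite !jmE (absolute_traceE p_prime card_L').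
rewrite -(rmorph_nat j) (absolute_traceE p_prime card_K) rmorph_sum /=.
under eq_bigr do rewrite rmorphXn /= (ftraceE j p_prime card_K card_L).
have powD i : {morph (fun x : L => x ^+ (p ^ i)) : x y / x + y}.
  have := @expD_cardX p 1 (s * d) _ L p_prime (etrans (card_Fp p_prime) (esym (expn1 p))).
  by rewrite card_Fp // => /(_ card_L' i).
have pow0 i : (0 : L) ^+ (p ^ i) = 0 by rewrite expr0n expn_eq0 -leqn0 leqNgt prime_gt0.
under eq_bigr do rewrite (big_morph _ (@powD _) (pow0 _)).
rewrite exchange_big /=.
rewrite -(big_mkord predT (fun m => x ^+ (p ^ m))) /= mulnC.
rewrite big_nat_mul; apply/esym; rewrite [LHS]big_mkord; apply: eq_bigr => l _.
rewrite -{1}[(l * s)%N]add0n big_addn mulSn addnK big_mkord; apply: eq_bigr => i _.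
by rewrite -exprM card_K -expnM -expnD mulnC addnC.
Qed.

(** * Lines and labels of blocks *)

Section Fibers.

Variables (T T' : finType) (f : T -> T').

(** [A] may exceed the image of [f]: labels that are not attained only produce the empty set, which
    is removed. *)
Lemma fibers_preim_partition (A : {set T'}) : (forall x, f x \in A) ->
  [set [set x | f x == l] | l in A] :\ set0 = preim_partition f [set: T].
Proof.
move=> fA; apply/setP=> B; rewrite !inE; apply/andP/imsetP => [[B_neq0] | [x _ ->]].
  case/imsetP=> l _ defB; move: B_neq0; rewrite defB => /set0Pn[x].
  by rewrite inE => /eqP <-; exists x => //; apply/setP => y; rewrite !inE eq_sym.
split; first by apply/set0Pn; exists x; rewrite !inE eqxx.
by apply/imsetP; exists (f x) => //; apply/setP => y; rewrite !inE eq_sym.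
Qed.

Lemma card_preim_partition : #|preim_partition f [set: T]| = #|f @: [set: T]|.
Proof.
pose fiber l := [set y | l == f y].
have -> : preim_partition f [set: T] = fiber @: (f @: [set: T]).
  by rewrite -imset_comp; apply: eq_imset => x; apply/setP => y; rewrite !inE.
apply: card_in_imset => l l' /imsetP[x _ ->] /imsetP[x' _ ->] /setP/(_ x).
by rewrite !inE eqxx => /esym/eqP.
Qed.

End Fibers.

Section Lines.

Variables (Fr Fq : finFieldType) (j : {rmorphism Fr -> Fq}).

Definition line (v : Fq) : {set Fq} := [set j c * v | c : Fr].

Lemma lineP v w : reflect (exists c, w = j c * v) (w \in line v).
Proof.
by apply: (iffP imsetP) => [[c _ ->] | [c ->]]; [exists c | exists c; rewrite ?inE].
Qed.

Lemma line_id v : v \in line v.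
Proof. by apply/lineP; exists 1; rewrite rmorph1 mul1r. Qed.

Lemma line0 : line 0 = [set 0].
Proof.
apply/setP=> w; rewrite inE; apply/lineP/eqP => [[c ->] | ->].
  by rewrite mulr0.
by exists 0; rewrite mulr0.
Qed.

Lemma line_scale c v : c != 0 -> line (j c * v) = line v.
Proof.
move=> nz_c; apply/setP=> w; apply/lineP/lineP => -[d ->].
  by exists (d * c); rewrite rmorphM mulrA.
by exists (d / c); rewrite mulrA -rmorphM divfK.
Qed.

Lemma line_eq v w : w != 0 -> w \in line v -> line w = line v.
Proof.
move=> nz_w /lineP[c def_w]; rewrite def_w line_scale //.
by apply: contraNneq nz_w => c0; rewrite def_w c0 rmorph0 mul0r.
Qed.

Lemma line_eqE v w : (line w == line v) = (w \in line v) && ((v == 0) || (w != 0)).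
Proof.
apply/eqP/andP => [eq_wv | [wv]].
  split; first by rewrite -eq_wv line_id.
  have [w0 | nz_w] := eqVneq w 0; last by rewrite orbT.
  by have := line_id v; rewrite -eq_wv w0 line0 inE => ->.
case/orP => [/eqP v0 | nz_w]; last exact: line_eq.
by move: wv; rewrite v0 line0 inE => /eqP->; rewrite line0.
Qed.

Lemma line_flines v : (line v \in flines j) = (v != 0).
Proof.
apply/imsetP/idP => [[w nz_w /eqP] | nz_v]; last by exists v; rewrite ?inE.
rewrite -[X in _ == X]/(line w) line_eqE !inE in nz_w *.
by rewrite (negPf nz_w) => /andP[].
Qed.

Lemma flines_line (L : {set Fq}) w : L \in flines j ->
  (w \in L :\ 0) = (w != 0) && (line w == L).
Proof.
case/imsetP=> v; rewrite !inE => nz_v ->; rewrite -/(line v) line_eqE (negPf nz_v).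
by case: (w != 0); rewrite /= ?andbT ?andbF.
Qed.

Lemma card_line v : v != 0 -> #|line v| = #|Fr|.
Proof. by move=> nz_v; rewrite card_imset // => c d /(mulIf nz_v)/fmorph_inj. Qed.

(** The nonzero vectors are sorted by the line that they span. *)
Lemma card_flines : (#|flines j| * #|Fr|.-1 = #|Fq|.-1)%N.
Proof.
have -> : #|Fq|.-1 = #|[set~ (0 : Fq)]| by rewrite cardsC1.
rewrite -[RHS]sum1_card (partition_big line (mem (flines j))) => [|v]; last first.
  by rewrite !inE line_flines.
rewrite -sum_nat_const; apply: eq_bigr => L LF.
have [v nz_v defL] := imsetP LF; rewrite !inE in nz_v.
rewrite sum1_card -(card_line nz_v) -/(line v) in defL *.
rewrite [in LHS](cardsD1 0 (line v)) -defL.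
have -> : 0 \in L by rewrite defL; apply/lineP; exists 0; rewrite rmorph0 mul0r.
by apply: eq_card => w; rewrite flines_line // [RHS]unfold_in !inE.
Qed.

End Lines.

Section Labels.

Variables (p : nat) (Vn : vectType 'F_p) (Fr Fq : finFieldType) (j : {rmorphism Fr -> Fq}).

Local Notation T := (finvect_type Vn).
Local Notation V := (ambient Vn Fq).

(** The three summands encode the blocks c_{L,i}, the blocks e_i, and the blocks B_L together with
    {0}. *)
Definition label_type : finType := ({set Fq} * Fr + (Fr + {set Fq}))%type.

(* The block of Omega containing a given vector is encoded by a label; blocks *)
(* {0} and B_L both correspond to lines, with 0 spanning {0}.                 *)
Definition label (f : Fq -> T -> Fr) (v : V) : label_type :=
  if v.2 != 0 then inl (line j v.2, H_fun j f v)
  else if v.1.1 != 0 then inr (inl (f 0 v.1.1))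
  else inr (inr (line j v.1.2)).

(** The flag [b] tells whether e_0 occurs as a block. *)
Definition labels (b : bool) : {set label_type} :=
  [set l : label_type | match l with
    | inl Li => Li.1 \in flines j
    | inr (inl i) => (i != 0) || b
    | inr (inr L) => (L \in flines j) || (L == [set 0])
    end].

Lemma card_labels b :
  #|labels b| = (#|flines j| * #|Fr| + (#|Fr|.-1 + b + (#|flines j| + 1)))%N.
Proof.
rewrite -sum1_card big_sumType big_sumType /=; congr (_ + (_ + _))%N.
- rewrite sum1dep_card -[#|Fr|]cardsT -cardsX; apply: eq_card => -[L i].
  by rewrite !inE andbT.
- have Fr_gt0 : (0 < #|Fr|)%N by apply/card_gt0P; exists 0.
  rewrite sum1dep_card; case: b.
    by rewrite addn1 prednK //; apply: eq_card => i; rewrite !inE orbT.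
  by rewrite addn0 -(cardsC1 (0 : Fr)); apply: eq_card => i; rewrite !inE orbF.
- have not0 : [set 0] \notin flines j by rewrite -(line0 j) line_flines eqxx.
  rewrite sum1dep_card addnC -[1%N]/(true : nat) -not0 -cardsU1.
  by apply: eq_card => L; rewrite !inE orbC.
Qed.

Variable f : Fq -> T -> Fr.
Variable b : bool.
Hypothesis f_values : forall i, [exists x, (x != 0) && (f 0 x == i)] = (i != 0) || b.
Hypothesis trace_surj : forall a, exists x, ftrace j x = a.
Hypothesis traceZ : forall a x, ftrace j (j a * x) = a * ftrace j x.

Lemma label_in v : label f v \in labels b.
Proof.
rewrite /label !inE; case: ifP => [nz_v|_]; first by rewrite line_flines.
case: ifP => [nz_v|_] /=; last by rewrite line_flines;
  case: eqVneq => // ->; rewrite line0 eqxx.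
by rewrite -f_values; apply/existsP; exists v.1.1; rewrite nz_v eqxx.
Qed.

Lemma label_surj l : l \in labels b -> exists v, label f v = l.
Proof.
rewrite inE; case: l => [[L i] /= LF | [i | L]].
- have [w nz_w ->] := imsetP LF; rewrite !inE in nz_w.
  (* With x = 0 and z = w fixed, the trace term alone moves [H] to any prescribed value. *)
  have [y y_tr] := trace_surj (i - f w 0).
  exists ((0, y / w), w); rewrite /label /= nz_w /H_fun /= divfK // y_tr.
  by rewrite addrC subrK.
- rewrite -f_values => /existsP[x /andP[nz_x /eqP f_x]].
  by exists ((x, 0), 0); rewrite /label /= eqxx nz_x f_x.
case/orP => [LF | /eqP ->]; last first.
  by exists 0; rewrite /label /= !eqxx /= line0.
have [w nz_w ->] := imsetP LF; rewrite !inE in nz_w.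
by exists ((0, w), 0); rewrite /label /= !eqxx.
Qed.

Lemma label_image : label f @: setT = labels b.
Proof.
apply/setP => l; apply/imsetP/idP => [[v _ ->] | /label_surj[v <-]]; last by exists v.
exact: label_in.
Qed.

Lemma label_line v (L : {set Fq}) i : L \in flines j ->
  (label f v == inl (L, i)) = (v.2 \in L :\ 0) && (H_fun j f v == i).
Proof.
by move=> LF; rewrite (flines_line _ LF) /label; case: ifP => [nz|] /=; last case: ifP.
Qed.

Lemma label_value v i :
  (label f v == inr (inl i)) = [&& v.1.1 != 0, f 0 v.1.1 == i & v.2 == 0].
Proof.
rewrite /label; case: (v.2 == 0); rewrite /= ?andbF ?andbT //.
by case: (v.1.1 != 0).
Qed.

Lemma label_axis v (L : {set Fq}) : L \in flines j ->
  (label f v == inr (inr L)) = [&& v.1.1 == 0, v.1.2 \in L :\ 0 & v.2 == 0].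
Proof.
move=> LF; rewrite (flines_line _ LF) /label; case: (v.2 == 0); rewrite /= ?andbF ?andbT //.
case: (v.1.1 == 0) => //=; rewrite -[LHS]/(line j v.1.2 == L).
have [->|//] := eqVneq v.1.2 0.
by apply: contraTF LF => /eqP <-; rewrite line_flines eqxx.
Qed.

Lemma label_zero v : (label f v == inr (inr [set 0])) = (v == 0).
Proof.
rewrite /label; case: v => -[x y] w /=; rewrite -![_ == 0 :> V]/((_, _) == (0,0)) !xpair_eqE.
case: (w == 0); rewrite /= ?andbF ?andbT //.
case: (x == 0) => //=; rewrite -[LHS]/(line j y == [set 0]) -(line0 j) line_eqE eqxx andbT line0.
by rewrite inE.
Qed.

(** All labels in [labels b] are attained, so no fiber is empty, and [f_values] turns the side
    condition on e_0 into the flag [b]. *)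
Lemma Omega_labels :
  Omega j (f 0) (H_fun j f) = preim_partition (label f) [set: V].
Proof.
rewrite -(fibers_preim_partition label_in).
have fiber_neq0 l : l \in labels b -> [set x | label f x == l] != set0.
  by case/label_surj=> v <-; apply/set0Pn; exists v; rewrite inE.
rewrite (_ : _ :\ set0 = [set [set x | label f x == l] | l in labels b]); last first.
  apply/setP => B; rewrite !inE andb_idl // => /imsetP[l lb ->]; exact: fiber_neq0.
apply/setP => B; rewrite !inE; apply/idP/imsetP.
  case/orP => [/orP[/orP[/eqP-> | e_B] | /imset2P[L i LF _ ->]] | /imsetP[L LF ->]].
  - exists (inr (inr [set 0])); first by rewrite !inE eqxx orbT.
    by apply/setP => v; rewrite !inE label_zero.
  - have [i i_ok ->] := imsetP e_B; rewrite inE in i_ok; exists (inr (inl i)); last first.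
      by apply/setP => v; rewrite !inE label_value.
    rewrite inE; have [i0|//] := eqVneq i 0; move: i_ok; rewrite i0 eqxx => /set0Pn[v].
    rewrite inE => /and3P[nz_v /eqP f_v _]; have := f_values 0; rewrite eqxx => <-.
    by apply/existsP; exists v.1.1; rewrite nz_v f_v eqxx.
  - by exists (inl (L, i)); rewrite ?inE //; apply/setP => v; rewrite !inE label_line // !inE.
  - by exists (inr (inr L)); rewrite ?inE ?LF //; apply/setP => v; rewrite !inE label_axis // !inE.
case=> -[[L i] | [i | L]]; rewrite inE /=.
- move=> LF ->; apply/orP; left; apply/orP; right; apply/imset2P.
  by exists L i; rewrite ?inE //; apply/setP => v; rewrite !inE label_line // !inE.
- move=> i_ok ->; apply/orP; left; apply/orP; left; apply/orP; right; apply/imsetP.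
  exists i; last by apply/setP => v; rewrite !inE label_value.
  rewrite inE; apply/implyP => _.
  have := fiber_neq0 (inr (inl i)); rewrite inE => /(_ i_ok) /set0Pn[v].
  by rewrite inE label_value => v_ok; apply/set0Pn; exists v; rewrite inE.
case/orP => [LF -> | /eqP-> ->].
  apply/orP; right; apply/imsetP; exists L => //.
  by apply/setP => v; rewrite !inE label_axis // !inE.
apply/orP; left; apply/orP; left; apply/orP; left.
by apply/eqP/setP => v; rewrite !inE label_zero.
Qed.

End Labels.

(** * The partition with the last two coordinates interchanged *)

Section Swap.

Variables (p : nat) (Vn : vectType 'F_p) (Fr Fq : finFieldType) (j : {rmorphism Fr -> Fq}).

Local Notation T := (finvect_type Vn).
Local Notation V := (ambient Vn Fq).

(* An isometry of the ambient form that turns K into a function of the shape  *)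
(* of H.                                                                      *)
Definition twist (v : V) : V := ((v.1.1, - v.2), v.1.2).

Lemma twist_bij : bijective twist.
Proof.
by exists (fun v => ((v.1.1, v.2), - v.1.2)) => -[[x y] w]; rewrite /twist /= opprK.
Qed.

Variable f : Fq -> T -> Fr.
Hypothesis traceN : forall x, ftrace j (- x) = - ftrace j x.

Lemma H_twist v : H_fun j f (twist v) = K_fun j f v.
Proof. by rewrite /H_fun /K_fun /= mulNr traceN mulrC. Qed.

(** [Omega_swap] ranges over all values and then discards the empty set, so the full set
    [labels j true] serves here without knowing whether [f 0] has a nonzero zero. *)
Lemma Omega_swap_labels :
  Omega_swap j (f 0) (K_fun j f) = preim_partition (label j f \o twist) [set: V].
Proof.
rewrite -(fibers_preim_partition (A := labels j true)) => [|v]; last first.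
  rewrite /= /label; case: ifP => [nz_v|_]; first by rewrite inE line_flines.
  by case: ifP => _; rewrite inE /= ?orbT // line_flines;
    case: eqVneq => // ->; rewrite line0 eqxx.
congr (_ :\ _).
have c_fiber (L : {set Fq}) i : L \in flines j ->
    c_swap (K_fun j f) L i = [set x | (label j f \o twist) x == inl (L, i)].
  by move=> LF; apply/setP => v; rewrite !inE label_line // H_twist /= !inE.
have e_fiber i : e_swap Fq (f 0) i = [set x | (label j f \o twist) x == inr (inl i)].
  by apply/setP => v; rewrite !inE label_value.
have B_fiber (L : {set Fq}) : L \in flines j ->
    B_swap Vn L = [set x | (label j f \o twist) x == inr (inr L)].
  move=> LF; apply/setP => v; rewrite !inE label_axis // (flines_line _ LF) /=.
  have -> : line j (- v.2) = line j v.2.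
    by rewrite -mulN1r -(rmorphN1 j) line_scale // oppr_eq0 oner_eq0.
  rewrite oppr_eq0 -(flines_line _ LF) !inE.
  by case: (v.1.1 == 0); case: (v.1.2 == 0); rewrite /= ?andbF ?andbT.
have zero_fiber : [set 0] = [set x | (label j f \o twist) x == inr (inr [set 0])].
  apply/setP => v; rewrite !inE label_zero; case: v => -[x y] w.
  rewrite -![_ == 0 :> V]/((_, _) == (0,0)) /= !xpair_eqE oppr_eq0.
  by rewrite -!andbA; congr (_ && _); rewrite andbC.
apply/setP => B; rewrite !inE; apply/idP/imsetP.
  case/orP => [/orP[/orP[/eqP-> | e_B] | /imset2P[L i LF _ ->]] | /imsetP[L LF ->]].
  - by exists (inr (inr [set 0])); rewrite ?inE ?eqxx ?orbT.
  - by have [i _ ->] := imsetP e_B; exists (inr (inl i)); rewrite ?e_fiber // inE orbT.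
  - by exists (inl (L, i)); rewrite ?inE ?c_fiber.
  - by exists (inr (inr L)); rewrite ?inE ?LF ?B_fiber.
case=> -[[L i] | [i | L]]; rewrite inE /=.
- move=> LF ->; rewrite -c_fiber //; apply/orP; left; apply/orP; right.
  by apply/imset2P; exists L i; rewrite ?inE.
- move=> _ ->; rewrite -e_fiber; apply/orP; left; apply/orP; left; apply/orP; right.
  exact: imset_f.
case/orP => [LF -> | /eqP-> ->].
  by rewrite -B_fiber //; apply/orP; right; apply: imset_f.
by rewrite -zero_fiber eqxx.
Qed.

End Swap.

(** * Walsh transforms of weakly regular functions *)

Section WeaklyRegular.

Variables (C : numClosedFieldType) (z : C) (p n : nat).
Hypotheses (p_prime : prime p) (p_odd : odd p) (z_prim : p.-primitive_root z).
Variables (T : finZmodType) (form : T -> T -> 'F_p).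
Hypotheses (form_perfect : perfect_pairing form) (n_even : ~~ odd n).
Hypothesis card_T : #|T| = (p ^ n)%N.

Let pX_neq0 m : p%:R ^+ m != 0 :> C.
Proof. by rewrite expf_neq0 // pnatr_eq0 -lt0n prime_gt0. Qed.

(** One hypothesis gives the sign [e] with some dual, the other gives the dual [g] with some signs;
    separating signs from roots of unity identifies the two expansions. *)
Lemma weakly_regular_dual (f g : T -> 'F_p) (e : C) :
  weakly_regular z n form f e -> is_dual z n form f g ->
  is_sign e /\ forall b, walsh z form f b = e * p%:R ^+ n./2 * z ^+ g b.
Proof.
case=> _ [g' f_g'] [e' f_g]; split=> [|b]; first by have [] := f_g' 0.
have [s_e Wg'] := f_g' b; have [s_e' Wg] := f_g b.
have [|ee' gg'] := sign_char_inj p_prime z_prim p_odd s_e s_e' (a := g' b) (b := g b).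
  by apply: (mulfI (pX_neq0 n./2)); rewrite !mulrA ![p%:R ^+ _ * _]mulrC -Wg' -Wg.
by rewrite Wg' gg'.
Qed.

(** Fourier inversion for [z ^+ f], after multiplication by e p^(n/2), whose square is |T| because
    [n] is even. *)
Lemma walsh_dual (f g : T -> 'F_p) (e : C) : is_sign e ->
    (forall b, walsh z form f b = e * p%:R ^+ n./2 * z ^+ g b) ->
  forall b, walsh z form g b = e * p%:R ^+ n./2 * z ^+ f (- b).
Proof.
move=> s_e Wf b; apply: (mulfI (mulf_neq0 (is_sign_neq0 s_e) (pX_neq0 n./2))).
have -> : e * p%:R ^+ n./2 * (e * p%:R ^+ n./2 * z ^+ f (- b)) = #|T|%:R * z ^+ f (- b).
  have ee : e * e = 1 by case: s_e => ->; rewrite ?mulrNN mulr1.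
  rewrite card_T -{3}(odd_double_half n) (negPf n_even) add0n -addnn natrX exprD.
  by rewrite mulrA [e * _ * _]mulrACA ee mul1r.
rewrite -(Fourier_inversion p_prime z_prim form_perfect (fun x => z ^+ f x)).
rewrite mulr_sumr; apply: eq_bigr => x _.
rewrite (charD p_prime z_prim) mulrA -Wf mulrC (pairingNr form_perfect).
rewrite (pairingC form_perfect x b); congr (_ * _).
by apply: eq_bigr => y _; rewrite (charD p_prime z_prim).
Qed.

Lemma norm_sign_char (e : C) (a : 'F_p) m : is_sign e ->
  `|e * p%:R ^+ m * z ^+ a| = p%:R ^+ m.
Proof.
move=> s_e; rewrite !normrM is_sign_norm // (norm_char p_prime z_prim) mul1r mulr1.
by rewrite normrX normr_nat.
Qed.

End WeaklyRegular.

(** * Value distribution of a vectorial bent function vanishing at 0 *)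

Section Values.

Variables (C : numClosedFieldType) (z : C) (p n s : nat).
Hypotheses (p_prime : prime p) (z_prim : p.-primitive_root z).
Variables (T : finZmodType) (form : T -> T -> 'F_p).
Hypotheses (form_perfect : perfect_pairing form) (n_even : ~~ odd n).
Hypotheses (card_T : #|T| = (p ^ n)%N) (s_le : (s <= n./2)%N).
Variables (F : finFieldType).
Hypothesis card_F : #|F| = (p ^ s)%N.
Variables (f : T -> F) (eps : F -> C).
Hypotheses (f0 : f 0 = 0) (eps_sign : forall t, t != 0 -> is_sign (eps t)).
Hypothesis walsh0 : forall t, t != 0 ->
  walsh z form (component p f t) 0 = eps t * p%:R ^+ n./2.

Local Notation tr := (@absolute_trace p F).
Local Notation S i := (\sum_(t | t != 0) eps t * z ^+ (tr (- (t * i)))).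

Let trace_pairing := absolute_trace_pairing p_prime card_F.
Let pn2_gt0 : (0 < p ^ n./2)%N. Proof. by rewrite expn_gt0 prime_gt0. Qed.

(** Orthogonality on [F] detects f(x) = i; the term t = 0 gives |T| = p^n, and the others are Walsh
    values at 0. *)
Lemma card_values i : (#|F| * #|[set x | f x == i]|)%:R
  = (p ^ n./2)%:R * ((p ^ n./2)%:R + S i).
Proof.
transitivity (\sum_x \sum_t z ^+ (tr (t * (f x - i)))).
  rewrite natrM -sum1_card natr_sum mulr_sumr big_mkcond; apply: eq_bigr => x _.
  rewrite (sum_char p_prime z_prim trace_pairing) subr_eq0 inE mulr1.
  by case: (f x == i); rewrite ?muln1 ?muln0.
rewrite exchange_big (bigD1 0) // mulrDr; congr (_ + _).
  under eq_bigr do rewrite mul0r (absolute_trace0 p_prime card_F) (char0 p_prime z_prim).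
  rewrite sumr_const cardT -cardE card_T -natrM -expnD addnn.
  by rewrite -{1}(odd_double_half n) (negPf n_even).
rewrite mulr_sumr; apply: eq_bigr => t nz_t.
rewrite mulrA natrX [_ * eps t]mulrC -walsh0 // /walsh mulr_suml; apply: eq_bigr => x _.
by rewrite (pairing0l form_perfect) subr0 -(charD p_prime z_prim)
  mulrBr (absolute_traceD p_prime card_F).
Qed.

Let cardF_le : (#|F| <= p ^ n./2)%N.
Proof. by rewrite card_F leq_pexp2l ?prime_gt0. Qed.

Let F_gt0 : (0 < #|F|)%N. Proof. by apply/card_gt0P; exists 0. Qed.

(** An empty fiber would make r - 1 numbers of modulus 1 add up to -p^(n/2), although r - 1 <
    p^(n/2). *)
Lemma value_neq0 i : i != 0 -> exists2 x, x != 0 & f x = i.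
Proof.
move=> nz_i; suff /set0Pn[x] : [set x | f x == i] != set0.
  rewrite inE => /eqP f_x; exists x => //.
  by apply: contraNneq nz_i => x0; rewrite -f_x x0 f0.
apply/negP => /eqP no_x; have := card_values i; rewrite no_x cards0 muln0 => /esym/eqP.
rewrite mulf_eq0 pnatr_eq0 -[_ == 0]negbK -lt0n pn2_gt0 addrC addr_eq0 => /eqP S_i.
have: `|S i| <= #|F|.-1%:R.
  apply: (le_trans (ler_norm_sum _ _ _)).
  rewrite (eq_bigr (fun=> 1)) => [|t nz_t]; last first.
    by rewrite normrM (norm_char p_prime z_prim) mulr1 (is_sign_norm (eps_sign nz_t)).
  rewrite sumr_const -(cardC1 (0 : F)) ler_nat; apply/eq_leq/eq_card => t.
  by rewrite !inE.
rewrite S_i normrN normr_nat ler_nat leqNgt (leq_trans _ cardF_le) //.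
by rewrite ltn_predL.
Qed.

(** At i = 0 the characters are trivial. With M positive signs the count becomes r |Z| = p^(n/2) X,
    where X = p^(n/2) - (r - 1) + 2M is at least 1. As r <= p^(n/2), |Z| = 1 forces r = p^(n/2) and
    X = 1, hence M = 0, and conversely. *)
Lemma value0 : [exists x, (x != 0) && (f x == 0)] =
  ~~ ((n == 2 * s)%N && [forall t : F, (t != 0) ==> (eps t == -1)]).
Proof.
pose Z := [set x | f x == 0].
pose M := #|[set t | (t != 0) && (eps t == 1)]|.
pose X := (p ^ n./2 - #|F|.-1 + 2 * M)%N.
have S0 : S 0 + #|F|.-1%:R = (2 * M)%:R.
  have -> : #|F|.-1%:R = \sum_(t : F | t != 0) 1 :> C.
    by rewrite sumr_const -(cardC1 (0 : F)); congr _%:R; apply: eq_card => t; rewrite !inE.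
  rewrite -big_split /= natrM /M -sum1_card natr_sum mulr_sumr big_mkcond [RHS]big_mkcond.
  apply: eq_bigr => t _; rewrite inE mulr0 oppr0 (absolute_trace0 p_prime card_F)
    (char0 p_prime z_prim) mulr1.
  case: ifP => //= nz_t; case: (eps_sign nz_t) => ->; rewrite ?eqxx ?mulr1 //.
  by rewrite addNr eqNr oner_eq0.
have cardX : (#|F| * #|Z| = p ^ n./2 * X)%N.
  apply/eqP; rewrite -(eqr_nat C) card_values natrM /X natrD -S0 natrB; last first.
    by rewrite (leq_trans (leq_pred _)).
  by rewrite addrCA subrK addrC.
have X_gt0 : (0 < X)%N.
  by rewrite /X addn_gt0 subn_gt0 (leq_trans _ cardF_le) // ltn_predL.
have set0_1 : ([exists x, (x != 0) && (f x == 0)]) = (1 < #|Z|)%N.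
  rewrite (cardsD1 (0 : T) Z) inE f0 eqxx ltnS.
  apply/existsP/card_gt0P => -[x x_ok]; exists x; move: x_ok; by rewrite !inE.
have card_gt0 : (0 < #|Z|)%N by apply/card_gt0P; exists 0; rewrite inE f0.
have M0 : (M == 0)%N = [forall t : F, (t != 0) ==> (eps t == -1)].
  rewrite cards_eq0; apply/eqP/forall_inP => [/setP M0 t nz_t | all_neg].
    have := M0 t; rewrite !inE nz_t /=; case: (eps_sign nz_t) => ->; by rewrite eqxx.
  apply/setP=> t; rewrite !inE; apply: contraTF isT => /andP[nz_t /eqP e1].
  by have := all_neg _ nz_t; rewrite e1 -addr_eq0 -(natrD _ 1 1) pnatr_eq0.
rewrite set0_1 ltnNge; congr (~~ _); rewrite -M0.
have nE : (n == 2 * s)%N = (#|F| == p ^ n./2)%N.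
  rewrite card_F eqn_exp2l ?prime_gt1 // -{1}(odd_double_half n) (negPf n_even) add0n.
  by rewrite mul2n eq_sym (inj_eq double_inj).
rewrite nE; apply/idP/andP => [le1 | [/eqP F_eq M_eq]].
  have N1 : #|Z| = 1%N by apply/eqP; rewrite eqn_leq le1.
  move: cardX; rewrite N1 muln1 => F_eq.
  have F_eq' : #|F| = (p ^ n./2)%N.
    by apply/eqP; rewrite eqn_leq cardF_le F_eq leq_pmulr.
  split; first by rewrite F_eq'.
  move/eqP: F_eq; rewrite F_eq' -{1}[(p ^ _)%N]muln1 eqn_pmul2l // /X F_eq'.
  rewrite -[in X in (X - _)%N](prednK pn2_gt0) subSnn add1n eqSS eq_sym muln_eq0 //.
rewrite -(leq_pmul2l F_gt0) muln1 cardX /X (eqP M_eq) muln0 addn0 -F_eq.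
by rewrite -[X in (X - _)%N](prednK F_gt0) subSnn muln1.
Qed.

Lemma values_exist i : [exists x, (x != 0) && (f x == i)] = (i != 0) ||
  ~~ ((n == 2 * s)%N && [forall t : F, (t != 0) ==> (eps t == -1)]).
Proof.
have [-> | nz_i] := eqVneq i 0; first exact: value0.
by have [x nz_x f_x] := value_neq0 nz_i; apply/existsP; exists x; rewrite nz_x f_x eqxx.
Qed.

End Values.

(** * Character sums on the ambient space *)

Section CharacterSums.

Variables (C : numClosedFieldType) (z : C) (p s d : nat).
Hypotheses (p_prime : prime p) (z_prim : p.-primitive_root z).
Variables (Fr Fq : finFieldType) (j : {rmorphism Fr -> Fq}).
Hypotheses (card_Fr : #|Fr| = (p ^ s)%N) (card_Fq : #|Fq| = (#|Fr| ^ d)%N).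
Variables (Vn : vectType 'F_p) (form : Vn -> Vn -> 'F_p).

Local Notation T := (finvect_type Vn).
Local Notation V := (ambient Vn Fq).
Local Notation fT := (fin_form form).
Local Notation fV := (@ambient_form p Vn form Fq).
Local Notation trr := (@absolute_trace p Fr).
Local Notation trq := (@absolute_trace p Fq).

Hypothesis form_perfect : perfect_pairing (fT : T -> T -> 'F_p).

Let card_Fq' : #|Fq| = (p ^ (s * d))%N.
Proof. by rewrite card_Fq card_Fr expnM. Qed.

Let trace_r := absolute_trace_pairing p_prime card_Fr.
Let trace_q := absolute_trace_pairing p_prime card_Fq'.
Let zD := charD p_prime z_prim.

Lemma ambient_perfect : perfect_pairing (fV : V -> V -> 'F_p).
Proof.
split=> [u v | u v w | v fv0].
- rewrite /ambient_form [v.1.2 * _]mulrC [v.2 * _]mulrC; congr (_ + _ + _).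
  exact: (pairingC form_perfect).
- rewrite /ambient_form !mulrDl !(absolute_traceD p_prime card_Fq').
  rewrite -[form (u + v).1.1 w.1.1]/(fT (u.1.1 + v.1.1) w.1.1) (pairingDl form_perfect).
  by rewrite [X in X + _]addrACA [LHS]addrACA.
have x0 : v.1.1 = 0.
  case: form_perfect => _ _; apply=> x; have := fv0 ((x, 0), 0).
  by rewrite /ambient_form /= !mul0r !(absolute_trace0 p_prime card_Fq') !addr0.
have form0 (x : T) : form 0 x = 0 by apply: (pairing0l form_perfect).
have y0 : v.1.2 = 0.
  case: trace_q => _ _; apply=> y; have := fv0 ((0, y), 0).
  by rewrite /ambient_form /= form0 !mul0r !(absolute_trace0 p_prime card_Fq') addr0 add0r.
have w0 : v.2 = 0.
  case: trace_q => _ _; apply=> w; have := fv0 ((0, 0), w).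
  by rewrite /ambient_form /= form0 !mul0r !(absolute_trace0 p_prime card_Fq') !add0r.
by case: v x0 y0 w0 {fv0} => -[x y] w /= -> -> ->.
Qed.

Lemma twist_form (u v : V) : fV (twist u) (twist v) = fV u v.
Proof. by rewrite /ambient_form /= mulrNN addrAC. Qed.

(** Linearity and transitivity of the trace turn the bilinear term into a character of y, ready for
    orthogonality. *)
Lemma component_H f t (v : V) :
  component p (H_fun j f) t v = component p (f v.2) t v.1.1 + trq (v.1.2 * (j t * v.2)).
Proof.
rewrite /component /H_fun mulrDr (absolute_traceD p_prime card_Fr); congr (_ + _).
rewrite -(ftraceZ j p_prime card_Fr card_Fq).
by rewrite (absolute_trace_trans j p_prime card_Fr card_Fq) mulrCA.
Qed.

Lemma sum_ambient (R : nmodType) (A : pred Fq) (F : V -> R) :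
  \sum_(v | A v.2) F v = \sum_(w | A w) \sum_x \sum_y F ((x, y), w).
Proof.
under [RHS]eq_bigr do rewrite pair_bigA /=.
rewrite exchange_big pair_big /=.
by apply: eq_big => [[[x y] w] | [[x y] w] _].
Qed.

(** What the slice z = w contributes to a twisted character sum once y is summed out, provided that
    [j t * w = xi.1.2]; the other slices contribute 0. *)
Definition half_sum (f : Fq -> T -> Fr) t (xi : V) (w : Fq) : C :=
  #|Fq|%:R * z ^+ (- trq (xi.2 * w))%R * walsh z fT (component p (f w) t) xi.1.1.

Lemma char_slab (A : pred Fq) f t (xi : V) :
  \sum_(v | A v.2) z ^+ (component p (H_fun j f) t v) * z ^+ (- fV xi v)%R
    = \sum_(w | A w && (j t * w == xi.1.2)) half_sum f t xi w.
Proof.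
rewrite sum_ambient [RHS]big_mkcondr; apply: eq_bigr => w _.
transitivity (\sum_x z ^+ (component p (f w) t x - fT xi.1.1 x)%R * z ^+ (- trq (xi.2 * w))%R
   * \sum_y z ^+ trq (y * (j t * w - xi.1.2))).
  apply: eq_bigr => x _; rewrite mulr_sumr; apply: eq_bigr => y _.
  rewrite component_H /= -!zD; congr (z ^+ nat_of_ord _).
  rewrite /ambient_form /fin_form /= !opprD mulrBr (absolute_traceD p_prime card_Fq').
  rewrite (absolute_traceN p_prime card_Fq') [y * xi.1.2]mulrC.
  by rewrite [LHS]addrA [X in X - _ = _]addrACA [RHS]addrAC.
rewrite (sum_char p_prime z_prim trace_q) subr_eq0; case: ifP => _; last first.
  by apply: big1 => x _; rewrite muln0 mulr0.
rewrite muln1 /half_sum mulr_sumr; apply: eq_bigr => x _.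
by rewrite mulrC mulrA mulrAC.
Qed.

Lemma walsh_H f t (xi : V) : t != 0 ->
  walsh z fV (component p (H_fun j f) t) xi = half_sum f t xi (j t^-1 * xi.1.2).
Proof.
move=> nz_t.
have := char_slab predT f t xi; rewrite /= => slab.
rewrite /walsh; under eq_bigr do rewrite zD.
rewrite slab -[RHS](big_pred1_eq +%R); apply: eq_bigl => w /=.
have nz_jt : j t != 0 by rewrite fmorph_eq0.
by rewrite fmorphV (can2_eq (mulKf nz_jt) (mulVKf nz_jt)).
Qed.

(** The sum over y forces [xi.1.2 = 0]; the [- 1] accounts for x = 0, which the blocks e_i
    exclude. *)
Lemma char_plane (f : T -> Fr) t (xi : V) : f 0 = 0 ->
  \sum_(v : V | (v.1.1 != 0) && (v.2 == 0)) z ^+ (component p f t v.1.1) * z ^+ (- fV xi v)%R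
    = (#|Fq| * (xi.1.2 == 0))%:R * (walsh z fT (component p f t) xi.1.1 - 1).
Proof.
move=> f0; have comp0 : component p f t 0 = 0.
  by rewrite /component f0 mulr0 (absolute_trace0 p_prime card_Fr).
transitivity (\sum_(v : V | v.2 == 0)
    if v.1.1 != 0
    then z ^+ (component p f t v.1.1) * z ^+ (- fV xi v)%R else 0).
  by rewrite -big_mkcondr; apply: eq_bigl => v; rewrite andbC.
rewrite (sum_ambient (pred1 0)) big_pred1_eq.
transitivity (\sum_(x : T | x != 0) z ^+ (component p f t x - fT xi.1.1 x)%R *
   \sum_y z ^+ trq (y * - xi.1.2)).
  rewrite [RHS]big_mkcond; apply: eq_bigr => x _ /=; case: ifP => _; last by rewrite big1.
  rewrite mulr_sumr; apply: eq_bigr => y _; rewrite -!zD; congr (z ^+ nat_of_ord _).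
  rewrite /ambient_form /fin_form /= mulr0 (absolute_trace0 p_prime card_Fq') addr0.
  by rewrite mulrN (absolute_traceN p_prime card_Fq') [y * _]mulrC opprD addrA.
rewrite (sum_char p_prime z_prim trace_q) oppr_eq0 -mulr_suml mulrC; congr (_ * _).
rewrite /walsh [in RHS](bigD1 0) //= comp0 (pairing0r form_perfect) subrr (char0 p_prime z_prim).
by rewrite addrAC subrr add0r.
Qed.

Lemma walsh_component0 (f : T -> Fr) (a : T) :
  walsh z fT (component p f 0) a = (#|T| * (a == 0))%:R.
Proof.
rewrite -(oppr_eq0 a) -(sum_char p_prime z_prim form_perfect); apply: eq_bigr => x _.
rewrite /component mul0r (absolute_trace0 p_prime card_Fr) add0r.
by rewrite (pairingNr form_perfect) (pairingC form_perfect).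
Qed.

(* Fourier inversion on Fr. *)
Lemma level_sums (X : finType) (A : pred X) (h : X -> Fr) (g g' : X -> C) :
  (forall i, \sum_(v | A v && (h v == i)) g v = \sum_(v | A v && (h v == i)) g' v) <->
  (forall t, \sum_(v | A v) z ^+ trr (t * h v) * g v
    = \sum_(v | A v) z ^+ trr (t * h v) * g' v).
Proof.
split=> [eq_g t | eq_g i].
  rewrite !(partition_big h predT) //=; apply: eq_bigr => i _.
  transitivity (z ^+ trr (t * i) * \sum_(v | A v && (h v == i)) g v).
    by rewrite mulr_sumr; apply: eq_bigr => v /andP[_ /eqP->].
  by rewrite eq_g mulr_sumr; apply: eq_bigr => v /andP[_ /eqP->].
have level (g1 : X -> C) : #|Fr|%:R * \sum_(v | A v && (h v == i)) g1 v =
    \sum_t z ^+ trr (- (t * i)) * \sum_(v | A v) z ^+ trr (t * h v) * g1 v.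
  under [RHS]eq_bigr do rewrite mulr_sumr.
  rewrite exchange_big big_mkcondr mulr_sumr; apply: eq_bigr => v _.
  transitivity ((\sum_t z ^+ trr (t * (h v - i))) * g1 v).
    rewrite (sum_char p_prime z_prim trace_r) subr_eq0.
    by case: eqP; rewrite ?muln1 // muln0 mulr0 mul0r.
  rewrite mulr_suml; apply: eq_bigr => t _; rewrite mulrA -zD.
  by rewrite -(absolute_traceD p_prime card_Fr) mulrBr [t * _ - _]addrC.
apply: (mulfI (card_neq0 C Fr)); rewrite !level.
by apply: eq_bigr => t _; rewrite eq_g.
Qed.

Definition line_sum (L : {set Fq}) (b : Fq) : C := \sum_(y in L :\ 0) z ^+ (- trq (b * y))%R.

Lemma chi_B (L : {set Fq}) (xi : V) : chi z fV xi (B_ Vn L) = line_sum L xi.1.2.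
Proof.
have -> : B_ Vn L = [set (((0, y), 0) : V) | y in L :\ 0].
  apply/setP => -[[x y] w]; rewrite inE /=;
  apply/and3P/imsetP => [[/eqP-> yL /eqP->] | [y' yL [-> -> ->]]].
    by exists y.
  by rewrite !eqxx yL.
rewrite /chi big_imset => [|y y' _ _ []] //=; apply: eq_bigr => y _.
rewrite /ambient_form /= -/(fT xi.1.1 0) (pairing0r form_perfect) add0r mulr0.
by rewrite (absolute_trace0 p_prime card_Fq') addr0.
Qed.

(** For fixed L, the sums over all c_{L,i} are equivalent to the twisted sums [slab t L], and those
    over all e_i to [plane t], with t = 0 included in both. An omitted e_0 costs nothing, its sum
    being 0, and {0} always gives 1. *)
Lemma same_chiP (f : Fq -> T -> Fr) (xi xi' : V) : f 0 0 = 0 ->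
  let slab t (L : {set Fq}) (u : V) := \sum_(w in L :\ 0 | j t * w == u.1.2) half_sum f t u w in
  let plane t (u : V) := (u.1.2 == 0)%:R * (walsh z fT (component p (f 0) t) u.1.1 - 1) in
  reflect [/\ forall L, L \in flines j -> forall t, slab t L xi = slab t L xi',
              forall t, plane t xi = plane t xi' &
              forall L, L \in flines j -> line_sum L xi.1.2 = line_sum L xi'.1.2]
    [forall U in Omega j (f 0) (H_fun j f), chi z fV xi U == chi z fV xi' U].
Proof.
move=> f00 slab plane.
have slab_chi L :
    (forall i, chi z fV xi (c_ (H_fun j f) L i) = chi z fV xi' (c_ (H_fun j f) L i)) <->
    (forall t, slab t L xi = slab t L xi').
  have chi_c u i : chi z fV u (c_ (H_fun j f) L i) =
      \sum_(v : V | (v.2 \in L :\ 0) && (H_fun j f v == i)) z ^+ (- fV u v)%R.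
    by apply: eq_bigl => v; rewrite inE.
  have := level_sums (fun v : V => v.2 \in L :\ 0) (H_fun j f)
    (fun v => z ^+ (- fV xi v)%R) (fun v => z ^+ (- fV xi' v)%R).
  have slabE u t := char_slab (mem (L :\ 0)) f t u.
  move=> [lev1 lev2]; split=> [eq_chi t | eq_slab i].
    rewrite /slab -!slabE; apply: lev1 => i; rewrite -!chi_c; exact: eq_chi.
  rewrite !chi_c; apply: lev2 => t; have := eq_slab t; rewrite /slab -!slabE; exact.
have plane_chi : (forall i, chi z fV xi (e_ Fq (f 0) i) = chi z fV xi' (e_ Fq (f 0) i)) <->
    (forall t, plane t xi = plane t xi').
  have chi_e u i : chi z fV u (e_ Fq (f 0) i) =
      \sum_(v : V | ((v.1.1 != 0) && (v.2 == 0)) && (f 0 v.1.1 == i)) z ^+ (- fV u v)%R.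
    by apply: eq_bigl => v; rewrite inE andbAC -andbA.
  have := level_sums (fun v : V => (v.1.1 != 0) && (v.2 == 0)) (fun v => f 0 v.1.1)
    (fun v => z ^+ (- fV xi v)%R) (fun v => z ^+ (- fV xi' v)%R).
  have planeE u t : \sum_(v : V | (v.1.1 != 0) && (v.2 == 0))
      z ^+ trr (t * f 0 v.1.1) * z ^+ (- fV u v)%R = #|Fq|%:R * plane t u.
    by rewrite /plane mulrA -natrM; apply: (char_plane t u f00).
  move=> [lev1 lev2]; split=> [eq_chi t | eq_plane i].
    apply: (mulfI (card_neq0 C Fq)); rewrite -!planeE;
    apply: lev1 => i; rewrite -!chi_e; exact: eq_chi.
  rewrite !chi_e; apply: lev2 => t; have := planeE xi t; rewrite eq_plane -planeE; exact.
apply: (iffP forall_inP) => [eq_chi | [/= eq_slab eq_plane eq_line] U].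
  have eq_chi' U : U \in Omega j (f 0) (H_fun j f) -> chi z fV xi U = chi z fV xi' U.
    by move/eq_chi/eqP.
  split.
  - move=> L LF; apply/slab_chi => i; apply: eq_chi'; rewrite !inE.
    apply/orP; left; apply/orP; right; apply/imset2P; by exists L i; rewrite ?inE.
  - apply/plane_chi => i; case: (eqVneq (e_ Fq (f 0) i) set0) => [-> | nz_e].
      by rewrite /chi !big_set0.
    apply: eq_chi'; rewrite !inE.
    apply/orP; left; apply/orP; left; apply/orP; right; apply/imsetP.
    by exists i; rewrite ?inE ?nz_e ?implybT.
  - move=> L LF; rewrite -!chi_B; apply: eq_chi'; rewrite !inE.
    by apply/orP; right; apply: imset_f.
rewrite !inE => U_Om; apply/eqP; move: U_Om.
case/orP => [/orP[/orP[/eqP-> | e_U] | /imset2P[L i LF _ ->]] | /imsetP[L LF ->]].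
- by rewrite /chi !big_set1 !(pairing0r ambient_perfect).
- have [i _ ->] := imsetP e_U; exact: plane_chi.2.
- exact: (slab_chi L).2 (eq_slab L LF) i.
by rewrite !chi_B eq_line.
Qed.

End CharacterSums.

(** * The dual partition *)

Section LineSums.

Variables (C : numClosedFieldType) (z : C) (p s d : nat).
Hypotheses (p_prime : prime p) (z_prim : p.-primitive_root z).
Variables (Fr Fq : finFieldType) (j : {rmorphism Fr -> Fq}).
Hypotheses (card_Fr : #|Fr| = (p ^ s)%N) (card_Fq : #|Fq| = (#|Fr| ^ d)%N).

Local Notation trr := (@absolute_trace p Fr).
Local Notation trq := (@absolute_trace p Fq).

Let card_Fq' : #|Fq| = (p ^ (s * d))%N.
Proof. by rewrite card_Fq card_Fr expnM. Qed.

Lemma absolute_trace_inj (u u' : Fr) :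
  (forall t, t != 0 -> trr (t * u) = trr (t * u')) -> u = u'.
Proof.
move=> eq_tr; apply/eqP; rewrite -subr_eq0; apply/eqP.
case: (absolute_trace_pairing p_prime card_Fr) => _ _; apply=> t.
have [-> | nz_t] := eqVneq t 0; first by rewrite mul0r (absolute_trace0 p_prime card_Fr).
rewrite mulrBr (absolute_traceD p_prime card_Fr) (absolute_traceN p_prime card_Fr).
by rewrite eq_tr // subrr.
Qed.

(** With the zero vector restored, this is a full character sum over [Fr] in the coefficient [c],
    with frequency Tr(bv) in [Fr]. *)
Lemma line_sumE v b : v != 0 ->
  line_sum z p (line j v) b = (#|Fr| * (ftrace j (b * v) == 0))%:R - 1.
Proof.
move=> nz_v; rewrite /line_sum.
have -> : line j v :\ 0 = [set j c * v | c in [set~ 0]].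
  apply/setP => y; rewrite !inE; apply/andP/imsetP => [[nz_y /lineP[c def_y]] | [c]].
    exists c => //; rewrite !inE; apply: contraNneq nz_y => c0.
    by rewrite def_y c0 rmorph0 mul0r.
  by rewrite !inE => nz_c ->; rewrite mulf_neq0 ?fmorph_eq0 //; split=> //;
    apply/lineP; exists c.
rewrite big_imset => [|c c' _ _ /(mulIf nz_v)/fmorph_inj //].
apply: (addIr 1); rewrite subrK -oppr_eq0.
rewrite -(sum_char p_prime z_prim (absolute_trace_pairing p_prime card_Fr)).
rewrite [RHS](bigD1 0) // addrC mul0r (absolute_trace0 p_prime card_Fr) (char0 p_prime z_prim).
congr (_ + _); apply: eq_big => [c | c _]; first by rewrite !inE.
rewrite mulrN (absolute_traceN p_prime card_Fr) -(ftraceZ j p_prime card_Fr card_Fq).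
by rewrite (absolute_trace_trans j p_prime card_Fr card_Fq) mulrCA.
Qed.

Lemma line_scaleP b b' : line j b = line j b' -> exists2 c, c != 0 & b' = j c * b.
Proof.
move=> eq_l; have /lineP[c def_b'] : b' \in line j b by rewrite eq_l line_id.
have [c0 | nz_c] := eqVneq c 0; last by exists c.
have b'0 : b' = 0 by rewrite def_b' c0 rmorph0 mul0r.
have := line_id j b; rewrite eq_l b'0 line0 inE => /eqP ->.
by exists 1; rewrite ?oner_eq0 ?mulr0.
Qed.

(** The only values are r - 1 and -1; a nonzero factor lets the condition a = 0 be read off a
    product with a line sum. *)
Lemma line_sum_neq0 v b : v != 0 -> line_sum z p (line j v) b != 0.
Proof.
move=> nz_v; rewrite line_sumE // subr_eq0 -[1]/(1%:R) eqr_nat.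
by case: (_ == 0); rewrite ?muln0 // muln1 gtn_eqF // finNzRing_gt1.
Qed.

(* The line sums at b record the hyperplane orthogonal to b. *)
Lemma line_sum_eqP b b' :
  (forall L, L \in flines j -> line_sum z p L b = line_sum z p L b') <->
  line j b = line j b'.
Proof.
split=> [eq_sum | /line_scaleP[c nz_c ->] L /imsetP[v nz_v ->]]; last first.
  rewrite !inE in nz_v; rewrite -/(line j v) !line_sumE // -mulrA.
  by rewrite (ftraceZ j p_prime card_Fr card_Fq) mulf_eq0 (negPf nz_c).
have eq_orth v : (ftrace j (b * v) == 0) = (ftrace j (b' * v) == 0).
  have [-> | nz_v] := eqVneq v 0; first by rewrite !mulr0.
  have := eq_sum (line j v); rewrite line_flines => /(_ nz_v); rewrite !line_sumE //.
  move/addIr/eqP; rewrite eqr_nat eqn_pmul2l; last by apply/card_gt0P; exists 0.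
  by do 2!case: (_ == 0).
have trace_nd u : (forall v, ftrace j (u * v) = 0) -> u = 0.
  move=> u0; apply/eqP; apply: contraT => nz_u.
  have [x] := ftrace_neq0 j p_prime card_Fr card_Fq.
  by rewrite -[x](mulVKf nz_u) u0 eqxx.
have [b0 | nz_b] := eqVneq b 0.
  have -> : b' = 0.
    by apply: trace_nd => v; apply/eqP;
      rewrite -eq_orth b0 mul0r (ftrace0 j p_prime card_Fr card_Fq).
  by rewrite b0.
have [x0 tr_x0] := ftrace_surj j p_prime card_Fr card_Fq 1.
pose v0 := b^-1 * x0; have tr_v0 : ftrace j (b * v0) = 1 by rewrite mulVKf.
have trD := ftraceD j p_prime card_Fr card_Fq.
have trZ := ftraceZ j p_prime card_Fr card_Fq.
have trN := ftraceN j p_prime card_Fr card_Fq.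
(* Every [v] minus Tr(bv) [v0] is orthogonal to [b], hence to [b']; so [b'] minus Tr(b' v0) [b] is
   orthogonal to every [v]. *)
have def_b' : b' = j (ftrace j (b' * v0)) * b.
  apply/eqP; rewrite -subr_eq0; apply/eqP/trace_nd => v.
  have : ftrace j (b * (v - j (ftrace j (b * v)) * v0)) == 0.
    by rewrite mulrBr trD trN mulrCA trZ tr_v0 mulr1 subrr.
  rewrite eq_orth mulrBr mulrBl !trD !trN mulrCA trZ -mulrA trZ => /eqP.
  by rewrite [ftrace j (b * v) * _]mulrC.
apply/esym; rewrite [in LHS]def_b' line_scale //.
have : ftrace j (b * v0) != 0 by rewrite tr_v0 oner_eq0.
by rewrite eq_orth.
Qed.

End LineSums.

(** * The dual partition in terms of [G] and [K], and its consequences *)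

Section Main.

Variables (C : numClosedFieldType) (z : C) (p s d n : nat).
Hypotheses (p_prime : prime p) (p_odd : odd p) (z_prim : p.-primitive_root z).
Hypotheses (n_even : ~~ odd n) (s_le : (s <= n./2)%N).
Variables (Fr Fq : finFieldType) (j : {rmorphism Fr -> Fq}).
Hypotheses (card_Fr : #|Fr| = (p ^ s)%N) (card_Fq : #|Fq| = (#|Fr| ^ d)%N).
Variables (Vn : vectType 'F_p) (form : Vn -> Vn -> 'F_p).

Local Notation T := (finvect_type Vn).
Local Notation V := (ambient Vn Fq).
Local Notation fT := (fin_form form).
Local Notation fV := (@ambient_form p Vn form Fq).
Local Notation trr := (@absolute_trace p Fr).
Local Notation trq := (@absolute_trace p Fq).

Hypothesis card_T : #|T| = (p ^ n)%N.
Hypothesis form_perfect : perfect_pairing (fT : T -> T -> 'F_p).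

Variables (P G : Fq -> T -> Fr) (eps : Fq -> Fr -> C) (sigma0 : {perm Fr}).
Hypothesis P_scale : forall (w : Fq) (c : Fr), c != 0 -> P (j c * w) = P w.
Hypothesis P_vb : forall w, vectorial_bent z n fT (P w).
Hypothesis P_wr : forall w, weakly_regular_components z n fT (P w) (eps w).
Hypothesis P_inv : forall w, w != 0 -> inversion_type_by z n fT (P w) (G w).
Hypothesis P0_dual : vectorial_dual_by z n fT sigma0 (P 0) (G 0).
Hypotheses (P0_0 : P 0 0 = 0) (G0_0 : G 0 0 = 0).

Let traceZ := ftraceZ j p_prime card_Fr card_Fq.
Let traceN := ftraceN j p_prime card_Fr card_Fq.
Let trace_surj := ftrace_surj j p_prime card_Fr card_Fq.
Let card_Fq' : #|Fq| = (p ^ (s * d))%N.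
Proof. by rewrite card_Fq card_Fr expnM. Qed.
Let pm_neq0 : p%:R ^+ n./2 != 0 :> C.
Proof. by rewrite expf_neq0 // pnatr_eq0 -lt0n prime_gt0. Qed.
Let q_neq0 : #|Fq|%:R != 0 :> C := card_neq0 C Fq.

Definition has_zero_value :=
  ~~ ((n == 2 * s)%N && [forall t : Fr, (t != 0) ==> (eps 0 t == -1)]).

Lemma eps_sign w t : t != 0 -> is_sign (eps w t).
Proof. by move=> nz_t; have [_ [g g_W]] := P_wr w nz_t; have [] := g_W 0. Qed.

Lemma walsh_P w t a : w != 0 -> t != 0 ->
  walsh z fT (component p (P w) t) a = eps w t * p%:R ^+ n./2 * z ^+ component p (G w) t^-1 a.
Proof.
move=> nz_w nz_t; have [_ /(_ t nz_t) dual] := P_inv nz_w.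
exact: (weakly_regular_dual p_prime p_odd z_prim (P_wr w nz_t) dual).2.
Qed.

Lemma walsh_P0 t a : t != 0 ->
  walsh z fT (component p (P 0) t) a =
    eps 0 t * p%:R ^+ n./2 * z ^+ component p (G 0) (sigma0 t) a.
Proof.
move=> nz_t; have [_ _ _ /(_ t nz_t) dual] := P0_dual.
exact: (weakly_regular_dual p_prime p_odd z_prim (P_wr 0 nz_t) dual).2.
Qed.

Lemma component_eq0 (f : T -> Fr) t x : f x = 0 -> component p f t x = 0.
Proof. by move=> fx; rewrite /component fx mulr0 (absolute_trace0 p_prime card_Fr). Qed.

Lemma sigma0_eq0 t : (sigma0 t == 0) = (t == 0).
Proof.
have [_ _ sig _] := P0_dual.
have sig0 : sigma0 0 = 0 by rewrite (out_perm sig) // !inE eqxx.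
by rewrite -{1}sig0 (inj_eq perm_inj).
Qed.

Lemma values_P i : [exists x, (x != 0) && (P 0 x == i)] = (i != 0) || has_zero_value.
Proof.
apply: (values_exist p_prime z_prim form_perfect n_even card_T s_le card_Fr P0_0) => t nz_t.
  exact: eps_sign.
by rewrite walsh_P0 // component_eq0 // (char0 p_prime z_prim) mulr1.
Qed.

(** The component of [G 0] at t has the sign of the component of [P 0] at the preimage of t under
    [sigma0]; a permutation of the signs does not affect whether all are -1. *)
Lemma values_G i : [exists x, (x != 0) && (G 0 x == i)] = (i != 0) || has_zero_value.
Proof.
have nz_inv t : t != 0 -> (sigma0^-1)%g t != 0 by rewrite -sigma0_eq0 permKV.
rewrite (values_exist (eps := fun t => eps 0 ((sigma0^-1)%g t)) p_prime z_prim
  form_perfect n_even card_T s_le card_Fr G0_0).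
- congr (_ || ~~ (_ && _)); apply/forall_inP/forall_inP => neg t nz_t.
    by have := neg (sigma0 t); rewrite permK sigma0_eq0; apply.
  exact/neg/nz_inv.
- move=> t nz_t; exact/eps_sign/nz_inv.
move=> t nz_t; have nz_t' := nz_inv t nz_t.
have := walsh_dual p_prime z_prim form_perfect n_even card_T (eps_sign 0 nz_t')
  (fun a => walsh_P0 a nz_t') 0.
by rewrite permKV oppr0 (@component_eq0 (P 0)) // (char0 p_prime z_prim) mulr1.
Qed.

Lemma component_K t (xi : V) : component p (K_fun j G) t xi =
  component p (G xi.1.2) t xi.1.1 - trq (xi.2 * (j t * xi.1.2)).
Proof.
rewrite -(absolute_traceN p_prime card_Fq') -mulNr.
rewrite -(component_H p_prime j card_Fr card_Fq G t (twist xi)).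
by rewrite /component (H_twist _ traceN).
Qed.

(** Scaling invariance replaces the index t^-1 b by b, and the common factor t^-1 merges the dual
    value with the trace term. *)
Lemma half_sum_K t (xi : V) :
    (forall a, walsh z fT (component p (P xi.1.2) t) a
       = eps xi.1.2 t * p%:R ^+ n./2 * z ^+ component p (G xi.1.2) t^-1 a) ->
    t != 0 ->
  half_sum z form P t xi (j t^-1 * xi.1.2) =
    #|Fq|%:R * (eps xi.1.2 t * p%:R ^+ n./2 * z ^+ component p (K_fun j G) t^-1 xi).
Proof.
move=> W nz_t; rewrite /half_sum P_scale ?invr_eq0 // W component_K.
rewrite (charD p_prime z_prim) -!mulrA; congr (_ * _).
by rewrite mulrC -!mulrA.
Qed.

(** Both indices carry the same function, so its Walsh value at 0 has a single sign. *)
Lemma eps_scale b c t : b != 0 -> c != 0 -> t != 0 -> eps (j c * b) t = eps b t.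
Proof.
move=> nz_b nz_c nz_t.
have nz_cb : j c * b != 0 by rewrite mulf_neq0 ?fmorph_eq0.
have := walsh_P 0 nz_cb nz_t; rewrite P_scale // walsh_P // => eqW.
have [|//] := sign_char_inj p_prime z_prim p_odd (eps_sign (j c * b) nz_t) (eps_sign b nz_t)
  (a := component p (G (j c * b)) t^-1 0) (b := component p (G b) t^-1 0).
by apply: (mulfI pm_neq0); rewrite !mulrA ![p%:R ^+ _ * _]mulrC.
Qed.

Local Notation slab t L xi := (\sum_(w in L :\ 0 | j t * w == xi.1.2) half_sum z form P t xi w).

Lemma slab_axis t L (xi : V) : xi.1.2 = 0 ->
  slab t L xi = (t == 0)%:R * (#|Fq|%:R * (#|T| * (xi.1.1 == 0))%:R * line_sum z p L xi.2).
Proof.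
move=> b0; have [-> | nz_t] := eqVneq t 0; last first.
  rewrite mul0r big1 // => w /andP[]; rewrite !inE => /andP[nz_w _].
  by rewrite b0 mulf_eq0 fmorph_eq0 (negPf nz_t) (negPf nz_w).
rewrite mul1r mulr_sumr; apply: eq_big => [w | w _].
  by rewrite rmorph0 mul0r b0 eqxx andbT.
by rewrite /half_sum (walsh_component0 p_prime z_prim card_Fr form_perfect) mulrAC.
Qed.

Lemma slab_off_axis t L (xi : V) : L \in flines j -> xi.1.2 != 0 ->
  slab t L xi =
    if (t != 0) && (line j xi.1.2 == L)
    then half_sum z form P t xi (j t^-1 * xi.1.2) else 0.
Proof.
move=> LF nz_b; have [-> | nz_t] := eqVneq t 0.
  by rewrite big_pred0 // => w; rewrite rmorph0 mul0r eq_sym (negPf nz_b) andbF.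
have nz_jt : j t != 0 by rewrite fmorph_eq0.
have solve w : (j t * w == xi.1.2) = (w == j t^-1 * xi.1.2).
  by rewrite fmorphV (can2_eq (mulKf nz_jt) (mulVKf nz_jt)).
have inL : (j t^-1 * xi.1.2 \in L :\ 0) = (line j xi.1.2 == L).
  by rewrite (flines_line _ LF) line_scale ?invr_eq0 // mulf_neq0 // fmorph_eq0 invr_eq0.
rewrite /= -inL; case: ifP => b_L.
  rewrite -[RHS](big_pred1_eq +%R); apply: eq_bigl => w; rewrite solve.
  by apply: andb_idl => /eqP ->.
by rewrite big_pred0 // => w; rewrite solve; apply: contraFF b_L => /andP[wL /eqP <-].
Qed.

(** The sums over the B_L give the line of b. If b != 0, the slab sums over that line give every
    component of [K]. If b = 0, the untwisted slab sums decide whether a = 0 and then give the line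
    of c, while the plane sums give [G 0] at a nonzero a. *)
Lemma same_chi_label (xi xi' : V) :
  [forall U in Omega j (P 0) (H_fun j P), chi z fV xi U == chi z fV xi' U]
    = ((label j G \o @twist p Vn Fq) xi == (label j G \o @twist p Vn Fq) xi').
Proof.
have labelE (u : V) : (label j G \o @twist p Vn Fq) u =
    if u.1.2 != 0 then inl (line j u.1.2, K_fun j G u)
    else if u.1.1 != 0 then inr (inl (G 0 u.1.1)) else inr (inr (line j u.2)).
  rewrite /label /= (H_twist _ traceN); case: ifP => // _; case: ifP => // _.
  by rewrite -mulN1r -(rmorphN1 j) line_scale // oppr_eq0 oner_eq0.
rewrite !labelE; apply/(same_chiP p_prime z_prim j card_Fr card_Fq form_perfect)/eqP => //.
  case=> eq_slab eq_plane /(line_sum_eqP p_prime z_prim j card_Fr card_Fq) eq_line.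
  have eq_b0 : (xi.1.2 == 0) = (xi'.1.2 == 0).
    by apply: negb_inj; rewrite -!(line_flines j) eq_line.
  rewrite -eq_b0 -eq_line; case: (eqVneq xi.1.2 0) eq_b0 => [b0 | nz_b] /esym b'0 /=.
    move/eqP in b'0.
    (* On b = 0 every slab sum with t != 0 vanishes, so all the information sits at t = 0. *)
    have eq_axis L : L \in flines j -> (#|T| * (xi.1.1 == 0))%:R * line_sum z p L xi.2 =
        (#|T| * (xi'.1.1 == 0))%:R * line_sum z p L xi'.2.
      move=> LF; have := eq_slab L LF 0; rewrite !slab_axis // eqxx !mul1r -!mulrA.
      exact: mulfI.
    have LF1 : line j 1 \in flines j by rewrite line_flines oner_eq0.
    have line1 b := line_sum_neq0 p_prime z_prim j card_Fr card_Fq b (oner_neq0 Fq).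
    have T_neq0 : #|T|%:R != 0 :> C := card_neq0 C T.
    have := eq_axis _ LF1.
    case: (eqVneq xi.1.1 0) => [a0 | nz_a]; case: (eqVneq xi'.1.1 0) => [a'0 | nz_a'] /=;
      rewrite ?muln1 ?muln0 ?mul0r => eq_1.
    - do 2![congr inr]; apply/(line_sum_eqP p_prime z_prim j card_Fr card_Fq) => L LF.
      by apply: (mulfI T_neq0); have := eq_axis L LF; rewrite a0 a'0 eqxx muln1.
    - by case/eqP: (mulf_neq0 T_neq0 (line1 xi.2)).
    - by case/eqP: (mulf_neq0 T_neq0 (line1 xi'.2)).
    congr (inr (inl _)); apply: (absolute_trace_inj p_prime card_Fr) => t nz_t.
    have nz_t' : (sigma0^-1)%g t != 0 by rewrite -sigma0_eq0 permKV.
    have := eq_plane ((sigma0^-1)%g t); rewrite b0 b'0 eqxx !mul1r => /addIr.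
    rewrite !walsh_P0 // permKV => eqW.
    have [|//] := sign_char_inj p_prime z_prim p_odd (eps_sign 0 nz_t') (eps_sign 0 nz_t')
      (a := component p (G 0) t xi.1.1) (b := component p (G 0) t xi'.1.1).
    by apply: (mulfI pm_neq0); rewrite !mulrA ![p%:R ^+ _ * _]mulrC.
  have nz_b' : xi'.1.2 != 0 by rewrite b'0.
  congr (inl (_, _)); apply: (absolute_trace_inj p_prime card_Fr) => t nz_t.
  have nz_t' : t^-1 != 0 by rewrite invr_eq0.
  have LF : line j xi.1.2 \in flines j by rewrite line_flines.
  have := eq_slab _ LF t^-1; rewrite !slab_off_axis // eq_line nz_t' !eqxx /=.
  rewrite !half_sum_K // => [|a|a]; try exact: walsh_P.
  move/(mulfI q_neq0); rewrite invrK => eqW.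
  have [|//] := sign_char_inj p_prime z_prim p_odd
    (eps_sign xi.1.2 nz_t') (eps_sign xi'.1.2 nz_t')
    (a := component p (K_fun j G) t xi) (b := component p (K_fun j G) t xi').
  by apply: (mulfI pm_neq0); rewrite !mulrA ![p%:R ^+ _ * _]mulrC.
have line_eqE := line_sum_eqP p_prime z_prim j card_Fr card_Fq.
case: (eqVneq xi.1.2 0) => [b0 | nz_b]; case: (eqVneq xi'.1.2 0) => [b'0 | nz_b'] /=;
  [ | by case: ifP | by case: ifP | ]; last first.
  case=> eq_line eq_K; have [c nz_c b'E] := line_scaleP eq_line; split=> [L LF t | t | L].
  - rewrite !slab_off_axis // -eq_line; case: ifP => // /andP[nz_t _].
    rewrite !half_sum_K // => [|a|a]; try exact: walsh_P.
    (* Equal labels only place both second coordinates on one line, so constancy of the sign along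
       lines is needed. *)
    have <- : eps xi.1.2 t = eps xi'.1.2 t by rewrite b'E eps_scale.
    by rewrite /component eq_K.
  - by rewrite !mul0r.
  exact: (line_eqE _ _).2.
case: (eqVneq xi.1.1 0) => [a0 | nz_a]; case: (eqVneq xi'.1.1 0) => [a'0 | nz_a'] //=.
  case=> eq_line; split=> [L LF t | t | L _]; rewrite ?slab_axis // ?b0 ?b'0 ?a0 ?a'0 //.
  by rewrite ((line_eqE _ _).2 eq_line L LF).
case=> eq_G; split=> [L LF t | t | L _]; rewrite ?slab_axis ?b0 ?b'0 //.
  by rewrite (negPf nz_a) (negPf nz_a') !muln0 mulr0 !mul0r.
congr (_ * (_ - 1)); have [-> | nz_t] := eqVneq t 0.
  rewrite !(walsh_component0 p_prime z_prim card_Fr form_perfect).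
  by rewrite (negPf nz_a) (negPf nz_a').
by rewrite !walsh_P0 // /component eq_G.
Qed.

Lemma Omega_P : Omega j (P 0) (H_fun j P) = preim_partition (label j P) [set: V].
Proof. exact: (Omega_labels values_P trace_surj). Qed.

Lemma dual_partition_labels :
  dual_partition z fV (Omega j (P 0) (H_fun j P))
    = preim_partition (label j G \o @twist p Vn Fq) [set: V].
Proof.
apply: eq_imset => xi; apply/setP => xi'.
by rewrite [LHS]inE [RHS]inE -same_chi_label.
Qed.

Lemma card_Omega : #|Omega j (P 0) (H_fun j P)| = #|labels j has_zero_value|.
Proof.
by rewrite Omega_P card_preim_partition (label_image values_P trace_surj).
Qed.

(** The labelings by [P] and by [G] have the same image, as both are governed by [has_zero_value],
    and [twist] is onto. *)
Lemma Omega_reflexive : Fourier_reflexive z fV (Omega j (P 0) (H_fun j P)).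
Proof.
rewrite /Fourier_reflexive card_Omega dual_partition_labels card_preim_partition.
rewrite imset_comp -(label_image values_G trace_surj).
have [g _ gK] := twist_bij Vn Fq.
suff -> : @twist p Vn Fq @: [set: V] = [set: V] by [].
by apply/setP => v; rewrite inE; apply/imsetP; exists (g v).
Qed.

Lemma H_component_dual t : (forall t, t != 0 -> sigma0 t = t^-1) -> t != 0 ->
  forall xi, walsh z fV (component p (H_fun j P) t) xi =
    eps xi.1.2 t * p%:R ^+ (n + 2 * (s * d))./2 * z ^+ component p (K_fun j G) t^-1 xi.
Proof.
move=> sig nz_t xi; rewrite (walsh_H p_prime z_prim j card_Fr card_Fq) //.
rewrite half_sum_K // => [|a]; last first.
  have [-> | nz_b] := eqVneq xi.1.2 0; last exact: walsh_P.
  by rewrite walsh_P0 // sig.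
rewrite mul2n halfD (negPf n_even) odd_double doubleK add0n exprD card_Fq' natrX.
by rewrite mulrC -!mulrA; do 2!congr (_ * _); rewrite mulrC.
Qed.

Lemma H_fun_bent (f : Fq -> T -> Fr) : (forall w, vectorial_bent z n fT (f w)) ->
  vectorial_bent z (n + 2 * (s * d)) fV (H_fun j f).
Proof.
move=> f_bent t nz_t xi; rewrite (walsh_H p_prime z_prim j card_Fr card_Fq) //.
rewrite /half_sum !normrM (f_bent _ t nz_t) (norm_char p_prime z_prim) mulr1 normr_nat.
by rewrite mul2n halfD (negPf n_even) odd_double doubleK add0n exprD card_Fq' natrX mulrC.
Qed.

Lemma G_bent w : vectorial_bent z n fT (G w).
Proof.
have [-> | nz_w] := eqVneq w 0; first by have [_ ?] := P0_dual.
move=> t nz_t a; have nz_t' : t^-1 != 0 by rewrite invr_eq0.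
rewrite -[t]invrK (walsh_dual p_prime z_prim form_perfect n_even card_T (eps_sign w nz_t')
  (fun a => walsh_P a nz_w nz_t')).
exact: norm_sign_char (eps_sign w nz_t').
Qed.

(** The isometry [twist] carries the Walsh transform of [K] to that of a function of the shape of
    [H] built from [G]. *)
Lemma K_fun_bent : vectorial_bent z (n + 2 * (s * d)) fV (K_fun j G).
Proof.
move=> t nz_t xi; rewrite -(H_fun_bent G_bent nz_t (twist xi)); congr `|_|.
rewrite /walsh [RHS](reindex_inj (bij_inj (twist_bij Vn Fq))); apply: eq_bigr => v _.
by rewrite twist_form /component (H_twist _ traceN).
Qed.

Lemma H_K_dual : (forall t, t != 0 -> sigma0 t = t^-1) ->
  vectorial_dual z (n + 2 * (s * d)) fV (H_fun j P) (K_fun j G).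
Proof.
(* The dual permutation is inversion, which fixes 0 by the convention on its inverse. *)
move=> sig; exists (perm (inv_inj (@invrK Fr))); split.
- exact: H_fun_bent P_vb.
- exact: K_fun_bent.
- by apply/subsetP => t; rewrite inE permE !inE; apply: contraNneq => ->; rewrite invr0.
move=> t nz_t; exists (fun xi : V => eps xi.1.2 t) => xi; rewrite permE.
by split; [exact: eps_sign | exact: H_component_dual].
Qed.

(** Negating z is scaling by -1 in [Fr], so it changes neither the line nor P^(z); evenness handles
    x, and the product yz is unchanged. *)
Lemma label_opp (v : V) : (forall w x, P w (- x) = P w x) -> label j P (- v) = label j P v.
Proof.
move=> P_even; have line_opp (w : Fq) : line j (- w) = line j w.
  by rewrite -mulN1r -(rmorphN1 j) line_scale // oppr_eq0 oner_eq0.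
rewrite /label /= !oppr_eq0 !line_opp !P_even; case: ifP => // _.
congr (inl (_, _)); rewrite /H_fun /= mulrNN P_even.
by rewrite -mulN1r -(rmorphN1 j) P_scale // oppr_eq0 oner_eq0.
Qed.

Lemma Omega_scheme : (forall w x, P w (- x) = P w x) ->
  symmetric_association_scheme #|Omega j (P 0) (H_fun j P)|.-1
    (difference_relations (Omega j (P 0) (H_fun j P))).
Proof.
move=> P_even.
apply: (Fourier_reflexive_scheme p_prime z_prim
  (ambient_perfect p_prime card_Fr card_Fq form_perfect)).
- by rewrite Omega_P; apply: preim_partitionP.
- exact: Omega_reflexive.
- by rewrite !inE eqxx.
rewrite Omega_P => S v /imsetP[u _ ->]; rewrite !inE => /eqP ->.
by rewrite label_opp ?eqxx.
Qed.

Lemma card_Omega_pred : #|Omega j (P 0) (H_fun j P)|.-1 =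
  ((p ^ (s * d) - 1) %/ (p ^ s - 1) * (p ^ s + 1) + (p ^ s - 1) + has_zero_value)%N.
Proof.
rewrite card_Omega card_labels; have := card_flines j.
rewrite card_Fq' card_Fr !subn1 => <-.
have Fr_gt1 := finNzRing_gt1 Fr; rewrite card_Fr in Fr_gt1.
rewrite mulnK; last by rewrite -ltnS prednK // ltnW.
by rewrite !addnA !addn1 /= mulnS addnC !addnA.
Qed.

End Main.

(** * The complex root of unity and the given bilinear form *)

Lemma zeta_expr (R : realType) (p m : nat) :
  zeta R p ^+ m = (cos (2 * pi / p%:R * m%:R) +i* sin (2 * pi / p%:R * m%:R))%C.
Proof.
rewrite /zeta; move: (2 * pi / p%:R) => x.
elim: m => [|m IHm]; first by rewrite mulr0 cos0 sin0.
rewrite exprSr IHm -natr1 mulrDr mulr1 cosD sinD.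
by apply/eqP; rewrite eq_complex /= [_ + cos _ * sin _]addrC !eqxx.
Qed.

(** The order divides the prime [p], and it is not 1 because sin(2 pi / p) > 0 for p > 2. *)
Lemma zeta_prim (R : realType) (p : nat) : prime p -> odd p ->
  p.-primitive_root (zeta R p).
Proof.
move=> p_prime p_odd; have p_gt0 : 0 < p%:R :> R by rewrite ltr0n prime_gt0.
have zeta_p : zeta R p ^+ p = 1.
  by rewrite zeta_expr divfK ?gt_eqF // mulr_natl cos2pi sin2pi.
have zeta_neq1 : zeta R p != 1.
  have : 0 < sin (2 * pi / p%:R : R).
    apply: sin_gt0_pi; rewrite divr_gt0 ?mulr_gt0 ?pi_gt0 //=.
    rewrite ltr_pdivrMr // mulrC ltr_pM2l ?pi_gt0 // ltr_nat.
    by apply: odd_prime_gt2.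
  by apply: contraTneq => -[_ ->]; rewrite ltxx.
have [m m_prim m_dvd] := prim_order_exists (prime_gt0 p_prime) zeta_p.
case/primeP: p_prime => _ /(_ m m_dvd) /orP[/eqP m1 | /eqP mp];
  last by rewrite mp in m_prim.
by move: (prim_expr_order m_prim); rewrite m1 expr1 => /eqP; rewrite (negPf zeta_neq1).
Qed.

Lemma symmetric_form_perfect (p : nat) (Vn : vectType 'F_p) (form : {symmetric Vn}) :
  nondegenerate form ->
  perfect_pairing (fin_form form : finvect_type Vn -> finvect_type Vn -> 'F_p).
Proof.
move=> /eqP nd; split=> [u v | u v w | v v_orth].
- by rewrite /fin_form hermC /= expr0 mul1r.
- exact: linearDl.
have : (v : Vn) \in orthov form fullv.
  by apply/mem_orthovP => u _; rewrite hermC; apply/eqP;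
    rewrite mulf_eq0; apply/orP; right; apply/eqP/v_orth.
by rewrite nd memv0 => /eqP.
Qed.

Theorem theorem4p2 (R : realType) (p k s n : nat)
  (p_prime : prime p) (p_odd : odd p) (s_dvd_k : (s %| k)%N)
  (n_even : ~~ odd n) (s_le : (s <= n./2)%N)
  (Fr Fq : finFieldType) (card_Fr : #|Fr| = (p ^ s)%N) (card_Fq : #|Fq| = (p ^ k)%N)
  (j : {rmorphism Fr -> Fq})
  (Vn : vectType 'F_p) (dim_Vn : \dim {:Vn} = n)
  (form : {symmetric Vn}) (form_nondeg : nondegenerate form)
  (P G : Fq -> finvect_type Vn -> Fr) (eps : Fq -> Fr -> R[i])
  (sigma0 : {perm Fr})
  (P_scale : forall (z : Fq) (c : Fr), c != 0 -> P (j c * z) = P z)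
  (P_vb : forall z : Fq, vectorial_bent (zeta R p) n (fin_form form) (P z))
  (P_wr : forall z,
     weakly_regular_components (zeta R p) n (fin_form form) (P z) (eps z))
  (P_inv : forall z : Fq, z != 0 ->
     inversion_type_by (zeta R p) n (fin_form form) (P z) (G z))
  (P0_dual : vectorial_dual_by (zeta R p) n (fin_form form) sigma0 (P 0) (G 0))
  (P0_0 : P 0 0 = 0) (G0_0 : G 0 0 = 0) :
  let formV := ambient_form (Fq := Fq) form in
  let H := H_fun j P in
  let K := K_fun j G in
  let Om := Omega j (P 0) H in
  let delta : nat :=
    if (n == 2 * s)%N && [forall t : Fr, (t != 0) ==> (eps 0 t == -1)]
    then 0%N else 1%N in
  [/\ partition Om [set: ambient Vn Fq],
      Fourier_reflexive (zeta R p) formV Om,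
      dual_partition (zeta R p) formV Om = Omega_swap j (G 0) K,
      (forall t, t != 0 -> sigma0 t = t^-1) ->
        vectorial_dual (zeta R p) (n + 2 * k) formV H K &
      (forall z x, P z (- x) = P z x) ->
        [/\ symmetric_association_scheme #|Om|.-1 (difference_relations Om),
            #|Om|.-1 =
              ((p ^ k - 1) %/ (p ^ s - 1) * (p ^ s + 1) + (p ^ s - 1) + delta)%N &
            s = k -> #|Om|.-1 = (2 * p ^ k + delta)%N]].
Proof.
move=> formV H K Om delta.
have z_prim := zeta_prim R p_prime p_odd.
have card_FqFr : #|Fq| = (#|Fr| ^ (k %/ s))%N.
  by rewrite card_Fr -expnM mulnC divnK.
have kE : (s * (k %/ s) = k)%N by rewrite mulnC divnK.
have card_T : #|finvect_type Vn| = (p ^ n)%N.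
  transitivity (#|'F_p| ^ \dim {: finvect_type Vn})%N; last first.
    by rewrite card_Fp // (dim_Vn : \dim {: finvect_type Vn} = n).
  by rewrite -card_vspace card_vspacef.
have form_perfect := symmetric_form_perfect form_nondeg.
have deltaE : delta = has_zero_value s n eps by rewrite /delta /has_zero_value; case: ifP.
have Om_card := card_Omega_pred p_prime p_odd z_prim n_even s_le j card_Fr card_FqFr
  card_T form_perfect P_wr P0_dual P0_0 G0_0.
rewrite kE -deltaE -/Om in Om_card.
split.
- rewrite /Om (Omega_P p_prime p_odd z_prim n_even s_le j card_Fr card_FqFr
    card_T form_perfect P_wr P0_dual P0_0 G0_0); exact: preim_partitionP.
- exact: (Omega_reflexive p_prime p_odd z_prim n_even s_le card_Fr card_FqFr
    card_T form_perfect P_scale P_wr P_inv P0_dual P0_0 G0_0).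
- rewrite (dual_partition_labels p_prime p_odd z_prim card_Fr card_FqFr
    form_perfect P_scale P_wr P_inv P0_dual P0_0).
  by rewrite (Omega_swap_labels _ (ftraceN j p_prime card_Fr card_FqFr)).
- rewrite -[in (n + 2 * k)%N]kE; exact: (H_K_dual p_prime p_odd z_prim
    n_even card_Fr card_FqFr
    card_T form_perfect P_scale P_vb P_wr P_inv P0_dual).
move=> P_even; split=> //.
  exact: (Omega_scheme p_prime p_odd z_prim n_even s_le card_Fr card_FqFr
    card_T form_perfect P_scale P_wr P_inv P0_dual P0_0 G0_0 P_even).
move=> s_k; have := finNzRing_gt1 Fq; rewrite Om_card s_k card_Fq => q_gt1.
(* There is a single line, and (q + 1) + (q - 1) = 2q. *)
rewrite divnn subn_gt0 q_gt1 mul1n addn1 subn1.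
by rewrite addSnnS prednK 1?ltnW // addnn -mul2n.
Qed.
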